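(* Let $M,d,n\in\mathbb{N}^+$ and $q>0$, let $v^*$ be the exact solution of the elliptic interface problem described in the context, with $v_i^*:=v^*|_{\Omega_i}\in B^4(\Omega_i)$ for $i=1,2$, let $F(\Omega)$ be the randomized hypothesis space with $C_B\ge C_q$, and let $\hat u\in F(\Omega)$ be the randomized neural network (RaNN) estimator computed on the random datasets with sample sizes $n_i=\mathcal{O}(n)$. Then $$\mathbb{E}_{\{\mathbf{x}\}}\big[L(\hat u)\big]\lesssim\inf_{u\in F(\Omega)}\|u-v^*\|_{X^\infty(\Omega)}^2+\frac{C_B^4\,M\log(C_BM(q+1)n)}{n},$$ where $\mathbb{E}_{\{\mathbf{x}\}}[\cdot]$ is the expectation with respect to the random sampling of the datasets, and $\|\cdot\|_{X^\infty(\Omega)}^2=\|\cdot\|_{C^2(\overline\Omega_1)}^2+\|\cdot\|_{C^2(\overline\Omega_2)}^2$.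
   Context: **Interface problem.** $\Omega\subset\mathbb{R}^d$ is a bounded domain and $\Gamma$ is a closed $C^2$-smooth interface separating $\Omega$ into an interior subdomain $\Omega_1$ and an exterior subdomain $\Omega_2=\Omega\setminus\Omega_1$. For a function $v$ on $\Omega$, $v_i$ denotes its restriction to $\Omega_i$. The coefficient $\beta>0$ is piecewise constant, $\beta=\beta_i$ on $\Omega_i$ (with high contrast: $\beta_1/\beta_2\gg1$ or $\beta_2/\beta_1\gg1$). The jump across $\Gamma$ is $[\![v]\!]:=v_2-v_1$, and $\mathbf{n}$ is the unit normal on $\Gamma$ pointing toward $\Omega_2$. The problem is $$-\nabla\cdot(\beta\nabla v)=g\ \text{in }\Omega,\qquad [\![\beta\nabla v\cdot\mathbf{n}]\!]=g_n,\ \ [\![v]\!]=g_d\ \text{on }\Gamma,\qquad v=g_b\ \text{on }\partial\Omega$$ (the PDE being understood in each subdomain). Assume $g\in L^2(\Omega)$, $g_n\in H^{1/2}(\Gamma)$, $g_d\in H^{3/2}(\Gamma)$, $g_b\in H^{3/2}(\partial\Omega)$, and also $g_i\in C^0(\Omega_i)$, $g_n,g_d\in C^0(\Gamma)$, $g_b\in C^0(\partial\Omega)$. The problem then has a unique solution $v^*\in H^2(\Omega_1)\cap H^2(\Omega_2)\cap L^\infty(\Omega)$. **Barron space.** With $\mathcal{F}_d[v](\vec\omega)=\int_{\mathbb{R}^d}v(\mathbf{x})e^{-i\vec\omega\cdot\mathbf{x}}d\mathbf{x}$, for $s\ge1$ and a bounded domain $D$, $B^s(D)=\{v\in L^2(D):\|v\|_{B^s(D)}<\infty\}$,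 where $\|v\|_{B^s(D)}=\inf_{v_e|_D=v}\int_{\mathbb{R}^d}(1+\|\vec\omega\|_1)^s|\mathcal{F}_d[v_e](\vec\omega)|\,d\vec\omega$, the infimum being over all extensions $v_e\in L^1(\mathbb{R}^d)$. **Hypothesis space.** Let $\pi_{\vec\omega,b}$ be any strictly positive probability density supported on $[-q,q]^{d+1}$. For a domain $D$, given i.i.d. hidden parameters $(\vec\omega_m,b_m)\sim\pi_{\vec\omega,b}$, $m=1,\dots,M$, which are fixed once sampled, $$\Sigma^{\tanh}_{M,q,C_B}(D)=\Big\{\sum_{m=1}^Ma_m\tanh(\vec\omega_m\cdot\mathbf{x}+b_m),\ \mathbf{x}\in D:\ \sum_{m=1}^M(1+\|\vec\omega_m\|)^2|a_m|\le C_B\Big\}.$$ Only the coefficients $a_m\in\mathbb{R}$ vary. $F(\Omega)$ is the set of functions $u$ with $u_1=u|_{\Omega_1}\in\Sigma^{\tanh}_{M,q,C_B}(\Omega_1)$ and $u_2=u|_{\Omega_2}\in\Sigma^{\tanh}_{M,q,C_B}(\Omega_2)$, with hidden parameters $(\vec\omega_m^i,b_m^i)$ on $\Omega_i$ and coefficients $a_m^i$. **Loss, data, estimator.** For $u\in F(\Omega)$ let $\ell_i=(\beta_i\Delta u_i+g_i)^2$ on $\Omega_i$ ($i=1,2$), $\ell_3=([\![\beta\nabla u\cdot\mathbf{n}]\!]-g_n)^2$ on $\Gamma$, $\ell_4=([\![u]\!]-g_d)^2$ on $\Gamma$, $\ell_5=(u_2-g_b)^2$ on $\partial\Omega$. Let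 $\lambda_1,\dots,\lambda_5>0$ be fixed penalty weights. The expected loss is $L(u)=\sum_{i=1}^5\lambda_i^2\,\mathbb{E}[\ell_i(\mathbf{x})]$, each expectation being with respect to the uniform distribution on the corresponding set ($\Omega_1,\Omega_2,\Gamma,\Gamma,\partial\Omega$). The datasets are i.i.d. uniform samples $\{\mathbf{x}_{i,j}\}_{j=1}^{n_i}$ on $\Omega_1,\Omega_2,\Gamma,\Gamma,\partial\Omega$ for $i=1,\dots,5$ respectively. The sample sizes are comparable to one another, $n_i=\mathcal{O}(n)$ (i.e. of the same order as $n$). The estimator $\hat u$ minimizes $\sum_{i=1}^5\lambda_i^2\sum_{j=1}^{n_i}\ell_i(\mathbf{x}_{i,j})$ over $u\in F(\Omega)$, i.e. over coefficient vectors $(a_m^i)$ subject to $\sum_m(1+\|\vec\omega_m^i\|)^2|a_m^i|\le C_B$, $i=1,2$. **Constant $C_q$.** Let $\psi(x)=\tanh(x)/(1+x^2)$. Fix $\rho\in C_c^\infty(\mathbb{R})$ supported in a closed interval excluding $0$ such that $C^{-1}:=(2\pi)^{d-1}\int_{\mathbb{R}}(1-\partial_w^2)[\rho](w)\,\mathcal{F}_1[\psi](w)\,dw$ is finite and nonzero. For $v\in B^4(D)$ let $v_A\in L^1(\mathbb{R}^d)$ be an extension of $v$ with $\int(1+\|\vec\omega\|_1)^4|\mathcal{F}_d[v_A]|d\vec\omega\le2\|v\|_{B^4(D)}$, let $\chi_A\in C_c^\infty(\mathbb{R}^d)$ with $\chi_A\equiv1$ on $\overline D$, set $v_E=\chi_Av_A$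 and $\alpha(\vec\omega,b)=\frac{1}{2\pi}\int_{\mathbb{R}}C\,\mathcal{F}_d[v_E](\vec\omega w)\,\rho(w)|w|^d\,e^{iwb}\,dw$. Then $C_q$ is the maximum over $i=1,2$ (with $D=\Omega_i$, $v=v_i^*$) of $\sup_{[-q,q]^{d}\times[-q,q]}\frac{(\|\vec\omega\|+1)^2|\alpha(\vec\omega,-b)|}{\pi_{\vec\omega,b}(\vec\omega,b)}<\infty$. **Convention.** $a\lesssim b$ means $a\le Cb$ with a generic constant $C>0$ independent of the primary parameters of interest; here these are $n,M,q,C_B$.
   Formalization: The formal theorem adds the hypothesis C_B ≥ 1: without it the bound fails, e.g. for v* = 0 with zero data (C_q = 0), M = n = 1 and C_B(q+1) < 1, where the infimum is 0 and the logarithm is negative. *)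

(* Defs.v *)
From HB Require Import structures.
From mathcomp Require Import all_boot all_order all_algebra.
From mathcomp Require Import complex.
From mathcomp Require Import all_classical all_reals all_analysis.

Set Implicit Arguments.
Unset Strict Implicit.
Unset Printing Implicit Defensive.

Import Order.TTheory GRing.Theory Num.Theory.
Import numFieldNormedType.Exports.

Local Open Scope classical_set_scope.
Local Open Scope ring_scope.

(* R^d carries the sigma-algebra generated by the coordinates, which is its
   Borel sigma-algebra. *)
Definition rV_display : measure_display.
Proof. exact: default_measure_display. Qed.

Section measurable_rV.
Variables (R : realType) (d : nat).

Definition coord_cylinders : set (set 'rV[R]_d) :=
  [set A | exists i : 'I_d, exists2 B : set R,
    measurable B & A = [set v : 'rV[R]_d | B (v 0 i)]].

Let rV_set0 : <<s coord_cylinders >> set0.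
Proof. exact: sigma_algebra0. Qed.

Let rV_setC A : <<s coord_cylinders >> A -> <<s coord_cylinders >> (~` A).
Proof. exact: sigma_algebraC. Qed.

Let rV_bigcup (F : (set 'rV[R]_d)^nat) :
  (forall i, <<s coord_cylinders >> (F i)) ->
  <<s coord_cylinders >> (\bigcup_i (F i)).
Proof. exact: sigma_algebra_bigcup. Qed.

HB.instance Definition _ := @isMeasurable.Build rV_display 'rV[R]_d
  <<s coord_cylinders >> rV_set0 rV_setC rV_bigcup.

Lemma measurable_coord (i : 'I_d) :
  measurable_fun [set: 'rV[R]_d] (fun v : 'rV[R]_d => v 0 i).
Proof.
move=> _ B mB; rewrite setTI; apply: sub_sigma_algebra.
by exists i, B.
Qed.

Lemma measurable_fun_rV d' (T : measurableType d') (f : T -> 'rV[R]_d) :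
  (forall i, measurable_fun [set: T] (fun t => f t 0 i)) ->
  measurable_fun [set: T] f.
Proof.
move=> mf.
apply: (@measurability _ _ _ _ setT f coord_cylinders) => //.
move=> _ [A [i [B mB ->]] <-].
exact: (mf i measurableT B mB).
Qed.

End measurable_rV.

Section lebesgue_rV.
Variable R : realType.

Definition box d (a b : 'rV[R]_d) : set 'rV[R]_d :=
  [set x | forall i, a 0 i <= x 0 i <= b 0 i].

Lemma measurable_box d (a b : 'rV[R]_d) : measurable (box a b).
Proof.
have -> : box a b = \bigcap_(i in [set: 'I_d])
    ((fun v : 'rV[R]_d => v 0 i) @^-1` `[a 0 i, b 0 i]).
  apply/seteqP; split => x /= h i => [_|]; first by rewrite /= in_itv /= h.
  by have := h i I; rewrite /= in_itv.
apply: fin_bigcap_measurable; first exact: finite_finset.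
move=> i _; rewrite -[X in measurable X]setTI.
exact: measurable_coord.
Qed.

Let snoc d (p : 'rV[R]_d * R) : 'rV[R]_d.+1 :=
  \row_i if unlift ord_max i is Some j then p.1 0 j else p.2.

Let snoc_max d p : @snoc d p 0 ord_max = p.2.
Proof. by rewrite mxE unlift_none. Qed.

Let snoc_lift d p j : @snoc d p 0 (lift ord_max j) = p.1 0 j.
Proof. by rewrite mxE liftK. Qed.

Let measurable_snoc d : measurable_fun setT (@snoc d).
Proof.
apply: measurable_fun_rV => i.
case: (unliftP ord_max i) => [j ->|->].
- apply: (eq_measurable_fun ((fun v : 'rV[R]_d => v 0 j) \o fst)).
    by move=> p _; rewrite snoc_lift.
  exact: measurableT_comp (@measurable_coord R d j) measurable_fst.
- apply: (eq_measurable_fun snd); last exact: measurable_snd.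
  by move=> p _; rewrite snoc_max.
Qed.

Lemma lebesgue_rV_exists d :
  exists mu : {measure set 'rV[R]_d -> \bar R},
  forall a b : 'rV[R]_d, (forall i, a 0 i <= b 0 i) ->
    mu (box a b) = (\prod_i (b 0 i - a 0 i))%:E.
Proof.
elim: d => [|d [mu muE]].
  exists (\d_(0 : 'rV[R]_0)) => a b _.
  rewrite big_ord0; transitivity ((\1_(box a b) (0 : 'rV[R]_0))%:E : \bar R).
    by [].
  by rewrite indicE mem_set// => -[].
exists (pushforward (mu \x (@lebesgue_measure R))%E (@snoc d)) => a b ab.
pose a' : 'rV[R]_d := \row_j a 0 (lift ord_max j).
pose b' : 'rV[R]_d := \row_j b 0 (lift ord_max j).
have snocE : @snoc d @^-1` box a b = box a' b' `*` `[a 0 ord_max, b 0 ord_max].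
  apply/seteqP; split => [[v t]|[v t] [h1 h2]] /=.
  - move=> h; split.
    + by move=> j; have := h (lift ord_max j); rewrite snoc_lift !mxE.
    + by have := h ord_max; rewrite snoc_max /= in_itv.
  - move=> i; case: (unliftP ord_max i) => [j ->|->].
    + by rewrite snoc_lift; have := h1 j; rewrite !mxE.
    + by rewrite snoc_max; move: h2; rewrite /= in_itv.
transitivity ((mu \x (@lebesgue_measure R))%E (@snoc d @^-1` box a b)) => //.
rewrite snocE product_measure1E//; last exact: measurable_box.
rewrite muE; last by move=> i; rewrite !mxE.
have lebE : @lebesgue_measure R `[a 0 ord_max, b 0 ord_max] =
    (b 0 ord_max - a 0 ord_max)%:E.
  rewrite lebesgue_measure_itv /= lte_fin; case: ltP => // ba.
  have -> : b 0 ord_max = a 0 ord_max by apply/eqP; rewrite eq_le ba ab.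
  by rewrite subrr.
transitivity ((\prod_i (b' 0 i - a' 0 i))%:E *
              (b 0 ord_max - a 0 ord_max)%:E)%E.
  by congr (_ * _)%E; exact: lebE.
rewrite -EFinM big_ord_recr /=; congr (_ * _)%:E.
apply: eq_bigr => i _; rewrite !mxE.
by congr (b 0 _ - a 0 _); apply/val_inj; rewrite /= /bump leqNgt ltn_ord.
Unshelve. all: exact: measurable_snoc.
Qed.

(* Lebesgue measure on R^d: boxes form a pi-system generating the Borel sets
   and exhausting R^d, so it is the only measure with the value of
   [lebesgue_rVE] on boxes. *)
Definition lebesgue_rV d : {measure set 'rV[R]_d -> \bar R} :=
  sval (cid (lebesgue_rV_exists d)).

Lemma lebesgue_rVE d (a b : 'rV[R]_d) : (forall i, a 0 i <= b 0 i) ->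
  lebesgue_rV d (box a b) = (\prod_i (b 0 i - a 0 i))%:E.
Proof. exact: (svalP (cid (lebesgue_rV_exists d))). Qed.

End lebesgue_rV.

Section euclidean_space.
Variables (R : realType) (d : nat).
Local Notation E := 'rV[R]_d.

Definition dot (x y : E) : R := \sum_i x 0 i * y 0 i.
Definition norm1 (x : E) : R := \sum_i `|x 0 i|.
Definition norm2 (x : E) : R := Num.sqrt (\sum_i x 0 i ^+ 2).

Definition diam (A : set E) : \bar R :=
  ereal_sup [set (norm2 (p.1 - p.2))%:E | p in A `*` A].

(* Hausdorff (outer) measure without the usual normalising constant; empty
   pieces of a cover count for 0, so that for s = 0 this is the counting
   measure. *)
Definition hausdorff_pre (s : nat) (delta : R) (A : set E) : \bar R :=
  ereal_inf [set (\sum_(0 <= k <oo)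
                    (if `[< F k = set0 >] then 0 else diam (F k) ^+ s))%E
            | F in [set F : (set E)^nat | A `<=` \bigcup_k F k /\
                      forall k, (diam (F k) <= delta%:E)%E]].

Definition hausdorff (s : nat) (A : set E) : \bar R :=
  ereal_sup [set hausdorff_pre s delta A | delta in [set delta : R | 0 < delta]].

(* [U] is the uniform distribution on [S] relative to [mu], i.e. [mu]
   restricted to [S] and normalised. *)
Definition uniform_on (mu : set E -> \bar R) (S : set E)
    (U : probability E R) : Prop :=
  [/\ (0 < mu S)%E, (mu S < +oo)%E &
      forall A, measurable A -> (U A * mu S)%E = mu (A `&` S)].

Definition pd (i : 'I_d) (f : E -> R) : E -> R :=
  fun x => 'D_(delta_mx 0 i : E) f x.

Definition pds (s : seq 'I_d) (f : E -> R) : E -> R := foldr pd f s.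

Definition grad (f : E -> R) (x : E) : E := \row_i pd i f x.

Definition laplacian (f : E -> R) (x : E) : R := \sum_i pds [:: i; i] f x.

Definition Ck_on (k : nat) (D : set E) (f : E -> R) : Prop :=
  forall s : seq 'I_d, (size s <= k)%N ->
    (forall x, D x -> {for x, continuous (pds s f)}) /\
    ((size s < k)%N ->
      forall i x, D x -> derivable (pds s f) x (delta_mx 0 i : E)).

(* C^k up to the boundary of the open set [D] *)
Definition Ck_closure (k : nat) (D : set E) (f : E -> R) : Prop :=
  Ck_on k D f /\
  forall s : seq 'I_d, (size s <= k)%N ->
    forall x, closure D x -> cvg (pds s f @ within D (nbhs x)).

(* boundary value at [x] of a function on [D] that is continuous up to the
   boundary *)
Definition trace (D : set E) (f : E -> R) (x : E) : R :=
  lim (f @ within D (nbhs x)).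

Definition test_function (D : set E) (f : E -> R) : Prop :=
  [/\ forall k, Ck_on k setT f, compact (closure [set x | f x != 0]) &
      closure [set x | f x != 0] `<=` D].

Definition sup_abs (D : set E) (f : E -> R) : \bar R :=
  ereal_sup [set `|f x|%:E | x in D].

(* Norm of C^2(closure D): the multi-indices of order 2 are the pairs i <= j.
   The suprema over D and over its closure agree for functions that are C^2 up
   to the boundary. *)
Definition C2_norm (D : set E) (f : E -> R) : \bar R :=
  (sup_abs D f + \sum_i sup_abs D (pd i f) +
   \sum_(i < d) \sum_(j < d | (i <= j)%N) sup_abs D (pds [:: i; j] f))%E.

Definition in_L2 (D : set E) (f : E -> R) : Prop :=
  measurable_fun D f /\
  (\int[lebesgue_rV R d]_(x in D) (f x ^+ 2)%:E < +oo)%E.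

Definition weak_derivative (D : set E) (s : seq 'I_d) (f w : E -> R) : Prop :=
  forall phi, test_function D phi ->
    \int[lebesgue_rV R d]_(x in D) (f x * pds s phi x) =
    (-1) ^+ size s * \int[lebesgue_rV R d]_(x in D) (w x * phi x).

Definition sobolev (m : nat) (D : set E) (f : E -> R) : Prop :=
  in_L2 D f /\
  forall s : seq 'I_d, (size s <= m)%N ->
    exists w, in_L2 D w /\ weak_derivative D s f w.

(* H^(m-1/2)(S) as the space of traces on [S] of functions in H^m(R^d): the
   test functions [phi k] converge in H^m(R^d), the limits of their partial
   derivatives being [w s], and their restrictions to [S] converge to [f] in
   L^2(S).  [U] is the uniform distribution on [S]; L^2(S) only depends on the
   surface measure up to a constant factor. *)
Definition trace_sobolev (m : nat) (S : set E) (U : probability E R)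
    (f : E -> R) : Prop :=
  exists (w : seq 'I_d -> E -> R) (phi : nat -> E -> R),
    [/\ forall k, test_function setT (phi k),
        forall s : seq 'I_d, (size s <= m)%N -> in_L2 setT (w s) /\
          (fun k => \int[lebesgue_rV R d]_x ((pds s (phi k) x - w s x) ^+ 2)%:E)%E
            @ \oo --> 0%E,
        measurable_fun S f &
        (fun k => \int[U]_(x in S) ((phi k x - f x) ^+ 2)%:E)%E @ \oo --> 0%E].

Definition fourier (f : E -> R) (om : E) : R[i] :=
  Complex (\int[lebesgue_rV R d]_x (f x * cos (dot om x)))
          (- \int[lebesgue_rV R d]_x (f x * sin (dot om x))).

Definition cmod (z : R[i]) : R := ComplexField.Normc.normc z.

Definition spectral_norm (s : nat) (f : E -> R) : \bar R :=
  (\int[lebesgue_rV R d]_om ((1 + norm1 om) ^+ s * cmod (fourier f om))%:E)%E.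

Definition L1_extension (D : set E) (f fe : E -> R) : Prop :=
  (lebesgue_rV R d).-integrable setT (EFin \o fe) /\
  {ae lebesgue_rV R d, forall x, D x -> fe x = f x}.

Definition barron_norm (s : nat) (D : set E) (f : E -> R) : \bar R :=
  ereal_inf [set spectral_norm s fe | fe in L1_extension D f].

Definition barron (s : nat) (D : set E) (f : E -> R) : Prop :=
  in_L2 D f /\ (barron_norm s D f < +oo)%E.

End euclidean_space.

Section interface.
Variables (R : realType) (d : nat).
Local Notation E := 'rV[R]_d.

(* Throughout, the index 0 : 'I_2 stands for the interior and 1 : 'I_2 for the
   exterior subdomain. *)
Record interface_problem := InterfaceProblem {
  Omega : set E ;
  Omega1 : set E ;
  normal : E -> E ;
  beta : 'I_2 -> R ;
  src : E -> R ;
  gN : E -> R ;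
  gD : E -> R ;
  gB : E -> R }.

Variable pb : interface_problem.

(* The open exterior subdomain; it differs from Omega \ Omega1 by the
   interface. *)
Definition Omega2 : set E := Omega pb `\` closure (Omega1 pb).
Definition subdomain (i : 'I_2) : set E := if i == 0 then Omega1 pb else Omega2.
Definition Gamma : set E := closure (Omega1 pb) `\` Omega1 pb.
Definition bdOmega : set E := closure (Omega pb) `\` Omega pb.

Definition local_equation (V : set E) (phi : E -> R) (x : E) : Prop :=
  [/\ open V, V x, Ck_on 2 V phi, grad phi x != 0 &
      forall y, V y -> [/\ Omega1 pb y <-> phi y < 0, Gamma y <-> phi y = 0 &
                           Omega2 y <-> 0 < phi y]].

Definition interface_geometry : Prop :=
  [/\ [/\ open (Omega pb), connected (Omega pb) & bounded_set (Omega pb)],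
      [/\ open (Omega1 pb), Omega1 pb !=set0 &
          closure (Omega1 pb) `<=` Omega pb],
      forall x, Gamma x -> exists V phi, local_equation V phi x,
      forall x V phi, Gamma x -> local_equation V phi x ->
        normal pb x = (norm2 (grad phi x))^-1 *: grad phi x &
      forall i, 0 < beta pb i].

(* The five sets on which the loss terms live, and the measures with respect
   to which their uniform distributions are taken. *)
Definition site (k : 'I_5) : set E :=
  match val k with
  | 0 => Omega1 pb
  | 1 => Omega2
  | 2 => Gamma
  | 3 => Gamma
  | _ => bdOmega
  end.

Definition site_measure (k : 'I_5) : set E -> \bar R :=
  if (k < 2)%N then (lebesgue_rV R d : set E -> \bar R) else hausdorff d.-1.

Definition data_regularity (U : 'I_5 -> probability E R) : Prop :=
  [/\ in_L2 (Omega pb) (src pb) /\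
        (forall i, {within subdomain i, continuous (src pb)}),
      trace_sobolev 1 Gamma (U (@Ordinal 5 2 isT)) (gN pb) /\
        {within Gamma, continuous (gN pb)},
      trace_sobolev 2 Gamma (U (@Ordinal 5 3 isT)) (gD pb) /\
        {within Gamma, continuous (gD pb)} &
      trace_sobolev 2 bdOmega (U (@Ordinal 5 4 isT)) (gB pb) /\
        {within bdOmega, continuous (gB pb)}].

(* [v] is the representative of the solution that is C^2 up to the boundary of
   each subdomain, which exists as soon as the solution is in B^4 of both
   subdomains; for it, the traces on the interface and on the boundary are
   limits. *)
Definition exact_solution (v : E -> R) : Prop :=
  [/\ (forall i, sobolev 2 (subdomain i) v /\ Ck_closure 2 (subdomain i) v) /\
        (exists K : R, {ae lebesgue_rV R d, forall x, Omega pb x -> `|v x| <= K}),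
      forall i x, subdomain i x -> - (beta pb i * laplacian v x) = src pb x,
      forall x, Gamma x ->
        \sum_i (beta pb 1 * trace Omega2 (pd i v) x -
                beta pb 0 * trace (Omega1 pb) (pd i v) x) * normal pb x 0 i
        = gN pb x,
      forall x, Gamma x ->
        trace Omega2 v x - trace (Omega1 pb) v x = gD pb x &
      forall x, bdOmega x -> trace Omega2 v x = gB pb x].

(* [u i] gives the function on the i-th subdomain. *)
Definition loss_term (u : 'I_2 -> E -> R) (k : 'I_5) (x : E) : R :=
  match val k with
  | 0 => (beta pb 0 * laplacian (u 0) x + src pb x) ^+ 2
  | 1 => (beta pb 1 * laplacian (u 1) x + src pb x) ^+ 2
  | 2 => (dot (beta pb 1 *: grad (u 1) x - beta pb 0 *: grad (u 0) x)
              (normal pb x) - gN pb x) ^+ 2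
  | 3 => (u 1 x - u 0 x - gD pb x) ^+ 2
  | _ => (u 1 x - gB pb x) ^+ 2
  end.

Definition expected_loss (lam : 'I_5 -> R) (U : 'I_5 -> probability E R)
    (u : 'I_2 -> E -> R) : \bar R :=
  (\sum_k (lam k ^+ 2)%:E * \int[U k]_(x in site k) (loss_term u k x)%:E)%E.

Definition empirical_loss (lam : 'I_5 -> R) (N : 'I_5 -> nat)
    (xs : forall k, 'I_(N k) -> E) (u : 'I_2 -> E -> R) : R :=
  \sum_k lam k ^+ 2 * \sum_(j < N k) loss_term u k (xs k j).

Definition X_norm2 (u : 'I_2 -> E -> R) : \bar R :=
  (\sum_i C2_norm (subdomain i) (u i) ^+ 2)%E.

End interface.

Section random_features.
Variables (R : realType) (d : nat).
Local Notation E := 'rV[R]_d.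
(* hidden parameters (omega, b), stored as one row *)
Local Notation param := 'rV[R]_(d + 1).

Definition weight (th : param) : E := lsubmx th.
Definition bias (th : param) : R := rsubmx th 0 0.

Definition tanh (x : R) : R := (expR x - expR (- x)) / (expR x + expR (- x)).

Definition rann (M : nat) (th : 'I_M -> param) (a : 'I_M -> R) (x : E) : R :=
  \sum_m a m * tanh (dot (weight (th m)) x + bias (th m)).

(* The coefficients parametrising F(Omega); the networks themselves are defined
   on the whole space. *)
Definition coefficients (M : nat) (th : 'I_2 -> 'I_M -> param) (CB : R) :
    set ('I_2 -> 'I_M -> R) :=
  [set a | forall i,
     \sum_m (1 + norm2 (weight (th i m))) ^+ 2 * `|a i m| <= CB].

Definition rann_pair (M : nat) (th : 'I_2 -> 'I_M -> param)
    (a : 'I_2 -> 'I_M -> R) : 'I_2 -> E -> R :=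
  fun i => rann (th i) (a i).

Definition cube (q : R) : set param := [set th | forall j, `|th 0 j| <= q].

Definition density_on_cube (q : R) (p : param -> R) : Prop :=
  [/\ measurable_fun setT p,
      forall th, cube q th -> 0 < p th,
      forall th, ~ cube q th -> p th = 0 &
      (\int[lebesgue_rV R (d + 1)]_th (p th)%:E)%E = 1%E].

Definition density_law (p : param -> R) (A : set param) : \bar R :=
  (\int[lebesgue_rV R (d + 1)]_(th in A) (p th)%:E)%E.

End random_features.

Definition iid (R : realType) (d1 d2 : measure_display) (T : measurableType d1)
    (P : probability T R) (T' : measurableType d2) (n : nat)
    (X : 'I_n -> T -> T') (law : set T' -> \bar R) : Prop :=
  [/\ forall j, measurable_fun setT (X j),
      forall j A, measurable A -> P (X j @^-1` A) = law A &
      forall A : 'I_n -> set T', (forall j, measurable (A j)) ->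
        P (\bigcap_j (X j @^-1` A j)) = (\prod_j P (X j @^-1` A j))%E].

Section constant_Cq.
Variables (R : realType) (d : nat).
Local Notation E := 'rV[R]_d.
Local Notation mu1 := (@lebesgue_measure R).
Local Notation RtoC x := (Complex x 0).

Definition cintegral (f : R -> R[i]) : R[i] :=
  Complex (\int[mu1]_w complex.Re (f w)) (\int[mu1]_w complex.Im (f w)).

Definition cexp (t : R) : R[i] := Complex (cos t) (sin t).

Definition fourier1 (f : R -> R) (w : R) : R[i] :=
  cintegral (fun x => RtoC (f x) * cexp (- (w * x))).

Definition psi (x : R) : R := tanh x / (1 + x ^+ 2).

Definition bump_off_0 (rho : R -> R) : Prop :=
  (forall k x, derivable (derive1n k rho) x 1) /\
  exists a b : R, ~ (a <= 0 <= b) /\ forall x, rho x != 0 -> a <= x <= b.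

(* the inverse of the constant C *)
Definition Cinv (rho : R -> R) : R[i] :=
  RtoC ((2 * pi) ^+ d.-1) *
  cintegral (fun w => RtoC (rho w - derive1n 2 rho w) * fourier1 psi w).

Definition barron_extension (D : set E) (v vA : E -> R) : Prop :=
  L1_extension D v vA /\
  (spectral_norm 4 vA <= 2%:E * barron_norm 4 D v)%E.

Definition cutoff (D : set E) (chi : E -> R) : Prop :=
  test_function setT chi /\ forall x, closure D x -> chi x = 1.

Definition alpha (rho : R -> R) (vE : E -> R) (om : E) (b : R) : R[i] :=
  RtoC (2 * pi)^-1 *
  cintegral (fun w => (Cinv rho)^-1 * fourier vE (w *: om) *
                      RtoC (rho w * `|w| ^+ d) * cexp (w * b)).

Definition Cq (rho : R -> R) (vA chi : 'I_2 -> E -> R) (q : R)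
    (p : 'rV[R]_(d + 1) -> R) : \bar R :=
  ereal_sup [set ereal_sup
    [set ((norm2 (weight th) + 1) ^+ 2 *
          cmod (alpha rho (fun x => chi i x * vA i x) (weight th) (- bias th))
          / p th)%:E | th in cube q] | i in [set: 'I_2]].

End constant_Cq.

(* Main.v *)
Require Import Defs.
From HB Require Import structures.
From mathcomp Require Import all_boot all_order all_algebra.
From mathcomp Require Import complex finmap.
From mathcomp Require Import all_classical all_reals all_analysis.
From mathcomp Require Import measurable_realfun ring lra.

Set Implicit Arguments.
Unset Strict Implicit.
Unset Printing Implicit Defensive.

Import Order.TTheory GRing.Theory Num.Theory.
Import numFieldNormedType.Exports.

Local Open Scope classical_set_scope.
Local Open Scope ring_scope.

(** The interface problem is linear and the exact solution solves it, so the loss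
of a network [u] at a point of one of the five sites is the square of a residual,
which is a linear form in the values, gradient and pure second derivatives of
[u - v] ([loss_termE]).  At points of the interface and of the boundary the
derivatives of [v] are traces.  Two bounds follow.  The residual is at most a
constant times the C2 distance between [u] and [v] ([residual_le_C2_norm]).  And,
since the constraint on the coefficients weighs each of them by the square of the
size of its inner weight, it is a Lipschitz function of the coefficients for the
norm of the constraint ([residual_lipschitz]).  As the derivatives of [v] are
bounded ([trace_solution_bounded]), all admissible losses are of order CB^2.

Consider now one site with N samples.  For a nonnegative loss bounded by B, the
mean minus twice the empirical mean has exponential moment of order N / (2 B) at
most 1 ([exp_moment_le1]), because exp (- y) <= 1 - y / 2 on [0, 1] and the
samples are independent ([integral_prod_iid]).  So over a finite class the largest
such difference has mean at most 2 B (1 + ln of the size of the class) / N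
([uniform_deviation]).  Rounding the coefficients to a grid with step 1 / (n M),
measured in the norm of the constraint, costs an error of order 1 / n and leaves
(2 (CB n M + 1))^(2 M) candidates at most, whose logarithm is of order
M ln (CB M n) ([grid_approx], [ln_card_grid]).  This gives the second term of the
bound ([site_deviation]).

For the first term, the empirical loss of the minimiser is at most that of any
other admissible network, which is at most a constant times the square of its C2
distance to [v] as soon as the samples lie in their sites, hence almost surely
([risk_bound_many]).

When n = 1 the logarithm in the rate can be arbitrarily small, because it also
tends to 0 with q.  But for small q all inner weights and biases are small, almost
surely, and all admissible networks are close to 0 in C2: their losses are
comparable to one another ([expected_loss_single]). *)

(** * Borel sets of a Euclidean space *)

Section borel_rV.
Variables (R : realType) (d : nat).
Local Notation E := 'rV[R]_d.

(** An open set is the union of the open boxes with rational corners that it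
contains, and there are countably many such boxes. *)
Lemma open_measurable_rV (A : set E) : open A -> measurable A.
Proof.
move=> oA.
pose B (ab : {ffun 'I_d -> rat} * {ffun 'I_d -> rat}) : set E :=
  \bigcap_(i in [set: 'I_d]) ((fun v : E => v 0 i) @^-1`
     `]ratr (ab.1 i), ratr (ab.2 i)[).
have mB ab : measurable (B ab).
  apply: fin_bigcap_measurable; first exact: finite_finset.
  by move=> i _; rewrite -[X in measurable X]setTI; exact: measurable_coord.
have -> : A = \bigcup_ab (if `[< B ab `<=` A >] then B ab else set0).
  apply/seteqP; split => [x Ax|x [ab _]]; last first.
    by case: asboolP => // + xB; exact.
  have [P xP PA] : nbhs x A by exact: open_nbhs_nbhs.
  have ex i : exists ab : rat * rat, [/\ ratr ab.1 < x 0 i, x 0 i < ratr ab.2 &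
      forall y, ratr ab.1 < y < ratr ab.2 -> P 0 i y].
    have /nbhs_ballP[e /= e0 eP] := xP 0 i.
    have [a /itvP ha] : exists q, ratr q \in `]x 0 i - e, x 0 i[.
      by apply: rat_in_itvoo; rewrite gtrBl.
    have [b /itvP hb] : exists q, ratr q \in `]x 0 i, x 0 i + e[.
      by apply: rat_in_itvoo; rewrite ltrDl.
    exists (a, b); split; rewrite /= ?ha ?hb// => y /andP[ay yb].
    apply: eP; rewrite /ball/= ltr_distlC; apply/andP; split.
      by apply: lt_trans ay; rewrite ha.
    by apply: lt_trans yb _; rewrite hb.
  have /choice[ab abP] := ex.
  pose AB := ([ffun i => (ab i).1], [ffun i => (ab i).2]).
  have BA : B AB `<=` A.
    move=> y yB; apply: PA => /= i j; rewrite ord1.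
    by have [_ _] := abP j; apply; have := yB j I; rewrite /= in_itv/= !ffunE.
  exists AB => //; rewrite asboolT// => i _.
  by rewrite /= in_itv/= !ffunE; have [-> ->] := abP i.
apply: countable_bigcupT_measurable => [|ab]; last by case: ifP.
exact: countableP.
Qed.

Lemma closed_measurable_rV (A : set E) : closed A -> measurable A.
Proof.
move=> cA; rewrite -(setCK A); apply: measurableC.
by apply: open_measurable_rV; rewrite openC.
Qed.

(** The part of [D] where [f] exceeds [a] is the trace on [D] of the open set of
points near which [f] exceeds [a] on [D]. *)
Lemma within_continuous_measurable_rV (D : set E) (f : E -> R) :
  measurable D -> (forall x, D x -> f @ within D (nbhs x) --> f x) ->
  measurable_fun D f.
Proof.
move=> mD cf; apply: (measurability _ (RGenOInfty.measurableE R)).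
move=> _ [_ [a ->] <-].
pose S := [set y | D y -> a < f y].
have -> : D `&` f @^-1` `]a, +oo[%classic = D `&` S°.
  apply/seteqP; split => x [Dx]; rewrite /= in_itv/= andbT.
    move=> afx; split=> //.
    exact: (cvgr_gt _ (cf x Dx)).
  by move=> /interior_subset Sx; split=> //; apply: Sx.
by apply: measurableI => //; apply: open_measurable_rV; exact: open_interior.
Qed.

Lemma continuous_measurable_rV (f : E -> R) :
  continuous f -> measurable_fun setT f.
Proof.
move=> cf; apply: within_continuous_measurable_rV => // x _.
by apply: cvg_trans (cf x); apply: cvg_app; exact: cvg_within.
Qed.

End borel_rV.

(** * Derivatives of tanh networks *)

Lemma cvg_fin_sum (R : realType) (T : Type) (F : set_system T) (FF : Filter F)
    (I : finType) (f : I -> T -> R) (l : I -> R) :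
  (forall i, f i @ F --> l i) -> (fun x => \sum_i f i x) @ F --> \sum_i l i.
Proof.
move=> fl; rewrite [X in X @ _](_ : _ = \sum_i f i); last first.
  by apply/funext => x; rewrite fct_sumE.
by elim/big_ind2 : _ => // [|f1 l1 f2 l2]; [exact: cvg_cst|exact: cvgD].
Qed.

Section rann_calculus.
Variables (R : realType) (d : nat).
Local Notation E := 'rV[R]_d.
Local Notation param := 'rV[R]_(d + 1).
Implicit Types (x : E) (s : seq 'I_d).

(** Reduces a directional derivative to a derivative in one real variable, where
the chain rule applies. *)
Lemma is_derive_line (f : E -> R) x v (df : R) :
  is_derive (0 : R) 1 (fun h => f (h *: v + x)) df -> is_derive x v f df.
Proof.
move=> [fd fE]; apply: DeriveDef; first exact: (iffRL (derivable1P f x v) fd).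
rewrite -fE /derive; set g1 := fun h => h^-1 *: _; set g2 := fun h => h^-1 *: _.
suff -> : g1 = g2 by [].
apply/funext => h; rewrite /g1 /g2 /=.
by rewrite addr0 scale0r add0r [_%:A]mulr1.
Qed.

Lemma tanh0 : tanh (0 : R) = 0.
Proof. by rewrite /tanh oppr0 subrr mul0r. Qed.

Lemma is_derive_tanh (t : R) : is_derive t 1 (@tanh R) (1 - tanh t ^+ 2).
Proof.
have h : expR t + expR (- t) != 0.
  by rewrite gt_eqF// addr_gt0 ?expR_gt0.
have dN : is_derive t 1 (fun u : R => expR (- u)) (- expR (- t)).
  have := @is_derive1_comp R expR -%R t (expR (- t)) (- 1) _ _.
  by rewrite mulrN1; apply.
have dd : is_derive t 1 (fun u : R => expR u + expR (- u))
    (expR t - expR (- t)) := is_deriveD (is_derive_expR t) dN.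
have dn : is_derive t 1 (fun u : R => expR u - expR (- u))
    (expR t + expR (- t)).
  by have := is_deriveB (is_derive_expR t) dN; rewrite opprK.
have dv := @is_deriveV R (fun u : R => expR u + expR (- u)) t _ 1 h dd.
have := is_deriveM dn dv; rewrite [X in is_derive _ _ X _](_ : _ = @tanh R)//.
move/is_derive_eq; apply.
rewrite /tanh /GRing.scale /=.
by field.
Qed.

Lemma tanh_sqr_le1 (t : R) : tanh t ^+ 2 <= 1.
Proof.
have h : 0 < expR t + expR (- t) by rewrite addr_gt0 ?expR_gt0.
rewrite /tanh expr_div_n ler_pdivrMr ?exprn_gt0// mul1r.
have a0 := expR_ge0 t; have b0 := expR_ge0 (- t).
nra.
Qed.

Lemma normr_tanh_le1 (t : R) : `|tanh t| <= 1.
Proof. by rewrite -(@expr_le1 _ 2)// real_normK ?num_real// tanh_sqr_le1. Qed.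

Lemma normr_tanh_le (t : R) : `|tanh t| <= `|t|.
Proof.
suff pos (u : R) : 0 <= u -> `|tanh u| <= u.
  have [t0|t0] := leP 0 t; first by rewrite (ger0_norm t0) pos.
  rewrite (ltr0_norm t0); have := pos (- t).
  rewrite /tanh opprK oppr_ge0 ltW// => /(_ isT).
  by rewrite -normrN -mulNr opprB [X in _ / X]addrC.
move=> u0.
have ct : {within `[0, u], continuous (@tanh R)}.
  apply: continuous_subspaceT => z.
  apply/differentiable_continuous/derivable1_diffP.
  by have [] := is_derive_tanh z.
have [c _] := MVT_segment u0 (fun t _ => is_derive_tanh t) ct.
rewrite tanh0 !subr0 => ->.
rewrite normrM (ger0_norm u0) ler_piMl// ger0_norm ?subr_ge0 ?tanh_sqr_le1//.
by rewrite gerBl sqr_ge0.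
Qed.

(** Since tanh' = 1 - tanh^2, every derivative of tanh is a polynomial in tanh;
this is the polynomial of the [k]-th derivative. *)
Definition tanh_poly (k : nat) : {poly R} :=
  iter k (fun P => P^`() * (1 - 'X^2)) 'X.

Definition tanhD (k : nat) (t : R) : R := (tanh_poly k).[tanh t].

Lemma is_derive_tanhD k (t : R) : is_derive t 1 (tanhD k) (tanhD k.+1 t).
Proof.
rewrite /tanhD /= hornerM !hornerE /=.
exact: (@is_derive1_comp R (fun u => (tanh_poly k).[u]) (@tanh R) t _ _
  (is_derive_poly (tanh_poly k) (tanh t)) (is_derive_tanh t)).
Qed.

Lemma continuous_tanhD k : continuous (tanhD k).
Proof.
move=> t; apply/differentiable_continuous/derivable1_diffP.
by have [] := is_derive_tanhD k t.
Qed.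

Variables (M : nat) (th : 'I_M -> param).
Implicit Types a : 'I_M -> R.

(** The partial derivative of a network along the directions in [s]: each of them
brings out one coordinate of the inner weight and differentiates tanh once. *)
Definition rannD s a x : R :=
  \sum_m a m * ((\prod_(i <- s) weight (th m) 0 i) *
                tanhD (size s) (dot (weight (th m)) x + bias (th m))).

Lemma is_derive_rannD s a i x :
  is_derive x (delta_mx 0 i : E) (rannD s a) (rannD (i :: s) a x).
Proof.
apply: is_derive_line; rewrite /rannD.
rewrite [X in is_derive _ _ X _](_ : _ = \sum_m (fun h : R =>
    a m * ((\prod_(i <- s) weight (th m) 0 i) *
    tanhD (size s) (h * weight (th m) 0 i + (dot (weight (th m)) x + bias (th m)))))).
  apply: is_derive_sum => m; set w := weight (th m); set c := (dot w x + _).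
  have da : is_derive (0 : R) 1 (fun h => h * w 0 i + c) (w 0 i).
    have := is_deriveD (is_deriveM (is_derive_id (0 : R) (1 : R))
      (is_derive_cst (w 0 i) (0 : R) (1 : R))) (is_derive_cst c (0 : R) (1 : R)).
    by move/is_derive_eq; apply; rewrite /GRing.scale/= mulr0 add0r addr0 mulr1.
  have dt := is_derive_tanhD (size s) (0 * w 0 i + c).
  have /(is_deriveZ (\prod_(i <- s) w 0 i))/(is_deriveZ (a m)) :=
    @is_derive1_comp R (tanhD (size s)) (fun h => h * w 0 i + c) 0 _ _ dt da.
  move/is_derive_eq; apply; rewrite /GRing.scale/= big_cons mul0r add0r.
  ring.
apply/funext => h; rewrite fct_sumE; apply: eq_bigr => m _.
congr (_ * (_ * tanhD _ _)); rewrite addrA; congr (_ + _).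
rewrite /dot (eq_bigr (fun j => (h * (weight (th m) 0 j * (j == i)%:R)) +
    weight (th m) 0 j * x 0 j)); last first.
  by move=> j _; rewrite !mxE eqxx/=; ring.
rewrite big_split/= -big_distrr/= (bigD1 i)//= eqxx mulr1 big1 ?addr0// => j ji.
by rewrite (negbTE ji) mulr0.
Qed.

Lemma pds_rann s a : pds s (rann th a) = rannD s a.
Proof.
elim: s => [|i s IH]; apply/funext => x.
  by apply: eq_bigr => m _; rewrite big_nil mul1r /tanhD hornerX.
by rewrite /= IH /pd; have [_ ->] := is_derive_rannD s a i x.
Qed.

Lemma derivable_pds_rann s a i x :
  derivable (pds s (rann th a)) x (delta_mx 0 i : E).
Proof. by rewrite pds_rann; have [] := is_derive_rannD s a i x. Qed.

Lemma continuous_dot (w : E) : continuous (dot w).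
Proof.
move=> x; rewrite /dot; apply: (@cvg_fin_sum R E (nbhs x)) => j.
by apply: cvgMl_tmp; exact: coord_continuous.
Qed.

Lemma continuous_rannD s a : continuous (rannD s a).
Proof.
move=> x; rewrite /rannD; apply: (@cvg_fin_sum R E (nbhs x)) => m.
have cd : {for x, continuous (fun y => dot (weight (th m)) y + bias (th m))}.
  exact: (cvgD (@continuous_dot (weight (th m)) x) (cvg_cst _)).
apply: cvgMl_tmp; apply: cvgMl_tmp; apply: (continuous_comp cd).
exact: continuous_tanhD.
Qed.

End rann_calculus.

Section rann_bounds.
Variables (R : realType) (d : nat).
Local Notation E := 'rV[R]_d.
Local Notation param := 'rV[R]_(d + 1).
Implicit Types (x w : E) (s : seq 'I_d).

Lemma ler_coord_norm2 w i : `|w 0 i| <= norm2 w.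
Proof.
rewrite -sqrtr_sqr; apply: ler_wsqrtr; rewrite (bigD1 i)//= lerDl.
by apply: sumr_ge0 => j _; exact: sqr_ge0.
Qed.

Lemma norm2_ge0 w : 0 <= norm2 w.
Proof. exact: sqrtr_ge0. Qed.

Lemma normr_tanhD_le2 k (t : R) : (k <= 2)%N -> `|tanhD k t| <= 2.
Proof.
have t1 := normr_tanh_le1 t; have t2 := tanh_sqr_le1 t.
have t3 : `|1 - tanh t ^+ 2| <= 1.
  by rewrite ger0_norm ?subr_ge0// gerBl sqr_ge0.
case: k => [|[|[|//]]] _; rewrite /tanhD /tanh_poly/=
  ?(derivX, mul1r, derivB, derivC, derivXn) !hornerE/=.
- by apply: le_trans t1 _; rewrite ler1n.
- by apply: le_trans t3 _; rewrite ler1n.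
- rewrite normrM normrN; apply: le_trans (_ : 2 * 1 <= _); last by rewrite mulr1.
  apply: ler_pM => //; apply: le_trans (ler_normD _ _) _.
  by rewrite -[2]/(1 + 1); exact: lerD.
Qed.

Variables (q r : R) (q_gt0 : 0 < q) (r_ge0 : 0 <= r).
Let kap := Num.min 1 q.

Lemma normr_dot_le w x (A B : R) :
  (forall i, `|w 0 i| <= A) -> (forall i, `|x 0 i| <= B) ->
  `|dot w x| <= d%:R * (A * B).
Proof.
move=> wA xB; apply: le_trans (ler_norm_sum _ _ _) _.
apply: le_trans (_ : \sum_(i < d) A * B <= _).
  by apply: ler_sum => i _; rewrite normrM ler_pM.
by rewrite sumr_const card_ord mulr_natl.
Qed.

(** The factor [Num.min 1 q] matters for small [q]: inner weights and biases below
[q] make the feature itself of order [q] on a bounded set, because tanh vanishes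
at 0, and make its derivatives carry a factor [q].  The square of the weight
matches the one in the constraint on the coefficients. *)
Lemma feature_bound s (th : param) x : (size s <= 2)%N -> cube q th ->
  (forall i, `|x 0 i| <= r) ->
  `|(\prod_(i <- s) weight th 0 i) * tanhD (size s) (dot (weight th) x + bias th)|
  <= (2 + d%:R * r) * kap * (1 + norm2 (weight th)) ^+ 2.
Proof.
move=> s2 cth xr; set w := weight th; set N := norm2 w.
have N0 : 0 <= N := norm2_ge0 w.
have wq i : `|w 0 i| <= q by rewrite mxE; exact: cth.
have bq : `|bias th| <= q by rewrite /bias mxE; exact: cth.
have kap_ge0 : 0 <= kap by rewrite le_min ler01 ltW.
have wkap i : `|w 0 i| <= kap * (1 + N).
  rewrite /kap; have [q1|q1] := leP q 1.
    apply: le_trans (wq i) _.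
    by rewrite ler_peMr; [|exact: ltW|rewrite lerDl].
  by rewrite mul1r; apply: le_trans (ler_coord_norm2 w i) _; rewrite lerDr.
have wN i : `|w 0 i| <= 1 + N.
  by apply: le_trans (ler_coord_norm2 w i) _; rewrite lerDr.
have dr0 : 0 <= d%:R * r by rewrite mulr_ge0.
have le_sqr : 1 + N <= (1 + N) ^+ 2 by rewrite ler_eXnr// lerDl.
have sqr1 : 1 <= (1 + N) ^+ 2 by rewrite exprn_ege1// lerDl.
have sqr0 : 0 <= (1 + N) ^+ 2 by exact: sqr_ge0.
have c0 : 0 <= 2 + d%:R * r by rewrite addr_ge0.
have tD := normr_tanhD_le2 _ s2; set y := dot w x + _.
rewrite normrM normr_prod; case: s s2 tD => [|i [|j [|//]]] _ /(_ y) tD.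
- rewrite big_nil mul1r /tanhD hornerX.
  apply: le_trans (_ : (1 + d%:R * r) * kap <= _); last first.
    apply: le_trans (_ : (2 + d%:R * r) * kap <= _).
      by rewrite ler_wpM2r// lerD2r ler1n.
    by rewrite ler_peMr// mulr_ge0.
  rewrite /kap; have [q1|q1] := leP q 1; last first.
    by rewrite mulr1; apply: le_trans (normr_tanh_le1 y) _; rewrite lerDl.
  apply: le_trans (normr_tanh_le y) _; apply: le_trans (ler_normD _ _) _.
  rewrite mulrDl mul1r addrC; apply: lerD => //.
  by apply: le_trans (normr_dot_le wq xr) _; rewrite [q * r]mulrC mulrA.
- rewrite big_seq1 -mulrA mulrC; apply: ler_pM => //.
    by apply: le_trans tD _; rewrite lerDl.
  by apply: le_trans (wkap i) _; rewrite ler_wpM2l.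
- rewrite big_cons big_seq1 -mulrA mulrC; apply: ler_pM => //.
    by apply: le_trans tD _; rewrite lerDl.
  by rewrite expr2 mulrA; apply: ler_pM.
Qed.

Variables (M : nat) (th : 'I_M -> param).
Hypothesis th_cube : forall m, cube q (th m).

(** The norm whose ball of radius [CB] is the admissible set of coefficients of
one subdomain. *)
Definition wnorm1 (a : 'I_M -> R) : R :=
  \sum_m (1 + norm2 (weight (th m))) ^+ 2 * `|a m|.

Lemma rannD_bound s a x : (size s <= 2)%N -> (forall i, `|x 0 i| <= r) ->
  `|rannD th s a x| <= (2 + d%:R * r) * kap * wnorm1 a.
Proof.
move=> s2 xr; apply: le_trans (ler_norm_sum _ _ _) _.
rewrite /wnorm1 mulr_sumr; apply: ler_sum => m _.
rewrite normrM mulrC mulrA ler_wpM2r//.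
exact: feature_bound.
Qed.

Lemma rannDB s a b x :
  rannD th s a x - rannD th s b x = rannD th s (fun m => a m - b m) x.
Proof. by rewrite -sumrB; apply: eq_bigr => m _; rewrite mulrBl. Qed.

End rann_bounds.

(** * Integrals and infima in the extended reals *)

Lemma lee_sum_term (R : realType) (I : finType) (P : pred I)
    (F : I -> \bar R) i : P i -> (forall j, 0 <= F j)%E ->
  (F i <= \sum_(j | P j) F j)%E.
Proof. by move=> Pi F0; rewrite (bigD1 i)//= leeDl// sume_ge0. Qed.

(** Lets a bound that holds for each competitor pass to the infimum over all
competitors, some of which may have infinite norm. *)
Lemma le_mul_ereal_infD (R : realType) (S : set \bar R) (z : \bar R) (c y : R) :
  0 < c -> (forall x, S x -> z <= c%:E * (x + y%:E))%E ->
  (z <= c%:E * (ereal_inf S + y%:E))%E.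
Proof.
move=> c0 zS; rewrite -lee_pdivrMl// -leeBlDr//.
by apply: le_ereal_inf_tmp => x Sx; rewrite leeBlDr// lee_pdivrMl//; exact: zS.
Qed.

Lemma integral_le_restrict d (T : measurableType d) (R : realType)
    (mu : probability T R) (S : set T) (f h : T -> R) (e : R) :
  measurable S -> mu S = 1%E -> 0 <= e ->
  measurable_fun S f -> measurable_fun S h ->
  (forall x, S x -> 0 <= f x) -> (forall x, S x -> 0 <= h x) ->
  (forall x, S x -> f x <= h x + e) ->
  (\int[mu]_(x in S) (f x)%:E <= \int[mu]_x ((h \_ S) x)%:E + e%:E)%E.
Proof.
move=> mS S1 e0 mf mh f0 h0 fh.
have -> : (\int[mu]_x ((h \_ S) x)%:E = \int[mu]_(x in S) (h x)%:E)%E.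
  by rewrite [RHS]integral_mkcond; apply: eq_integral => x _; rewrite /patch; case: ifP.
apply: (@le_trans _ _ (\int[mu]_(x in S) ((h x)%:E + e%:E))%E).
  apply: ge0_le_integral => //.
  - exact/measurable_EFinP.
  - by apply: emeasurable_funD => //; exact/measurable_EFinP.
rewrite ge0_integralD//; last exact/measurable_EFinP.
by rewrite integral_cst// [X in (_ * X)%E]S1 mule1.
Qed.

Lemma integral_le_cst d (T : measurableType d) (R : realType)
    (mu : probability T R) (S : set T) (f : T -> R) (c : R) :
  measurable S -> mu S = 1%E -> measurable_fun S f ->
  (forall x, S x -> 0 <= f x <= c) -> (\int[mu]_(x in S) (f x)%:E <= c%:E)%E.
Proof.
move=> mS S1 mf fc.
have -> : c%:E = (\int[mu]_(x in S) (cst c%:E) x)%E.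
  by rewrite integral_cst// [X in (_ * X)%E]S1 mule1.
apply: ge0_le_integral => //.
- by move=> x /fc/andP[].
- exact/measurable_EFinP.
- by move=> x /fc/andP[_ fx]; rewrite lee_fin.
Qed.

Section integral_upper_bound.
Context d (T : measurableType d) (R : realType).
Variable mu : {measure set T -> \bar R}.
Local Open Scope ereal_scope.

(** The integral of a nonnegative function is a supremum over the simple functions
below it, so it is monotone on all functions.  Making [g] infinite on the
exceptional null set reduces to a bound that holds everywhere. *)
Lemma le_integral_measurable_ub (f g : T -> \bar R) :
  (forall t, 0 <= f t) -> (forall t, 0 <= g t) -> measurable_fun setT g ->
  {ae mu, forall t, f t <= g t} ->
  \int[mu]_t f t <= \int[mu]_t g t.
Proof.
move=> f0 g0 mg [N [mN muN fgN]].
pose g' t := maxe (g t) (if t \in N then +oo else 0).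
have mg' : measurable_fun setT g'.
  apply: measurable_maxe => //.
  apply: measurable_fun_ifT; try exact: measurable_cst.
  by apply: (measurable_fun_bool true); rewrite setTI preimage_mem_true.
have g'0 t : 0 <= g' t by rewrite le_max g0.
have -> : \int[mu]_t g t = \int[mu]_t g' t.
  apply: ge0_ae_eq_integral => //.
  exists N; split=> // t; rewrite /= => gg'; apply: contrapT => Nt; apply: gg' => _.
  by rewrite /g' memNset// max_l.
have fg' t : f t <= g' t.
  rewrite /g'; case: ifPn => tN; first by rewrite max_r ?leey.
  rewrite le_max; apply/orP; left.
  apply: contrapT => h; move/negP: tN; apply; apply: mem_set; exact: fgN.
rewrite !ge0_integralTE//; apply: le_ereal_sup => _ [h hf <-].
by exists h => // t; apply: le_trans (hf t) _.
Qed.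

End integral_upper_bound.

(** * Products of functions of independent samples *)

Section expectation_product.
Context d1 (T : measurableType d1) d2 (T' : measurableType d2) (R : realType).
Variables (P : {measure set T -> \bar R}) (law : {measure set T' -> \bar R}).
Import HBNNSimple.
Local Open Scope ereal_scope.

(** Two measures that agree on sets, [A] being sent to the integral of [g] over
the event that [Y] is in [A], and to [c] times its law, integrate nonnegative
functions alike: pass from indicators to simple functions, then to monotone
limits. *)
Lemma integral_weighted_comp (g : T -> R) (Y : T -> T') (c : R) (f : T' -> R) :
  measurable_fun setT g -> (forall t, 0 <= g t)%R -> measurable_fun setT Y ->
  (0 <= c)%R ->
  (forall A, measurable A ->
     \int[P]_t (g t * \1_A (Y t))%:E = c%:E * law A) ->
  measurable_fun setT f -> (forall x, 0 <= f x)%R ->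
  \int[P]_t (g t * f (Y t))%:E = c%:E * \int[law]_x (f x)%:E.
Proof.
move=> mg g0 mY c0 indE mf f0.
have mF : measurable_fun setT (EFin \o f) by exact/measurable_EFinP.
pose h := nnsfun_approx measurableT mF.
have hf x : (fun n => (h n x)%:E) @ \oo --> (f x)%:E.
  by apply: (cvg_nnsfun_approx measurableT mF) => // z _; rewrite lee_fin.
have nd_h x : {homo (fun n => h n x) : m n / (m <= n)%N >-> (m <= n)%R}.
  by move=> m n mn; exact/lefP/nd_nnsfun_approx.
have mhY n : measurable_fun setT (fun t => g t * h n (Y t))%R.
  by apply: measurable_funM => //; exact: measurableT_comp.
have step n : \int[P]_t (g t * h n (Y t))%:E = c%:E * \int[law]_x (h n x)%:E.
  set s := fset_set (range (h n)).
  have s0 (i : 'I_#|`s|) : (0 <= s`_i)%R.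
    have : s`_i \in s by rewrite mem_nth// -cardfE.
    by rewrite in_fset_set// inE => -[x _ <-].
  have hE x : (h n x)%:E =
      \sum_(i < #|`s|) (s`_i)%:E * (\1_(h n @^-1` [set s`_i]) x)%:E.
    by rewrite (fimfunEord (h n)) -sumEFin; apply: eq_bigr => i _; rewrite EFinM.
  have mA r : measurable (h n @^-1` [set r]).
    by rewrite -[X in measurable X]setTI; exact: measurable_funP.
  under [in RHS]eq_integral do rewrite hE.
  under eq_integral.
    move=> t _; rewrite EFinM hE ge0_sume_distrr; last first.
      by move=> i _; rewrite mule_ge0 ?lee_fin.
    under eq_bigr do rewrite muleCA -[X in _ * X]EFinM.
    over.
  rewrite !ge0_integral_sum//.
  - rewrite ge0_sume_distrr; last first.
      by move=> i _; apply: integral_ge0 => x _; rewrite mule_ge0 ?lee_fin.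
    apply: eq_bigr => i _.
    rewrite !ge0_integralZl_EFin//.
    + by rewrite indE// integral_indic// setIT muleCA.
    + by apply/measurable_EFinP.
    + by move=> t _; rewrite lee_fin mulr_ge0.
    + apply/measurable_EFinP; apply: measurable_funM => //.
      exact: measurableT_comp.
  - move=> i; apply: measurable_funeM; exact/measurable_EFinP.
  - by move=> i x _; rewrite mule_ge0 ?lee_fin.
  - move=> i; apply: measurable_funeM; apply/measurable_EFinP.
    by apply: measurable_funM => //; exact: measurableT_comp.
  - by move=> i x _; rewrite mule_ge0 ?lee_fin// mulr_ge0.
have L : \int[law]_x (f x)%:E = limn (fun n => \int[law]_x (h n x)%:E).
  rewrite -monotone_convergence//.
  - by apply: eq_integral => x _; apply/esym/cvg_lim.
  - by move=> n; exact/measurable_EFinP.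
  - by move=> n x _; rewrite lee_fin.
  - by move=> x _ m n mn; rewrite lee_fin nd_h.
have LP : \int[P]_t (g t * f (Y t))%:E =
    limn (fun n => \int[P]_t (g t * h n (Y t))%:E).
  rewrite -monotone_convergence//.
  - apply: eq_integral => t _; apply/esym/cvg_lim => //.
    under eq_fun do rewrite EFinM.
    by rewrite EFinM; apply: cvgeZl => //; exact: hf.
  - by move=> n; exact/measurable_EFinP.
  - by move=> n t _; rewrite lee_fin mulr_ge0.
  - by move=> t _ m n mn; rewrite lee_fin ler_wpM2l// nd_h.
rewrite LP L; under eq_fun do rewrite step.
rewrite limeMl//.
apply: ereal_nondecreasing_is_cvgn => m n mn; apply: ge0_le_integral => //.
- by move=> x _; rewrite lee_fin.
- by apply/measurable_EFinP.
- by apply/measurable_EFinP.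
- by move=> x _; rewrite lee_fin nd_h.
Qed.

End expectation_product.

Section iid_product.
Context d1 (T : measurableType d1) d2 (T' : measurableType d2) (R : realType).
Variables (P : probability T R) (law : probability T' R).
Variables (N : nat) (X : 'I_N -> T -> T').
Hypothesis iidX : iid P X law.
Local Open Scope ereal_scope.

(** Independence is known for events, that is for indicators.  The indicators are
replaced by general functions one index after the other; each replacement is an
instance of [integral_weighted_comp], the weight [g] being the product of the
other factors. *)
Lemma integral_prod_iid (F : 'I_N -> T' -> R) :
  (forall j, measurable_fun setT (F j)) -> (forall j x, 0 <= F j x)%R ->
  (forall j, \int[law]_x (F j x)%:E < +oo) ->
  \int[P]_t (\prod_j F j (X j t))%:E = \prod_j \int[law]_x (F j x)%:E.
Proof.
have [mX lawX indX] := iidX.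
suff main k : (k <= N)%N -> forall F : 'I_N -> T' -> R,
    (forall j, measurable_fun setT (F j)) -> (forall j x, 0 <= F j x)%R ->
    (forall j, \int[law]_x (F j x)%:E < +oo) ->
    (forall j : 'I_N, (k <= j)%N -> exists2 A, measurable A & F j = \1_A) ->
    \int[P]_t (\prod_j F j (X j t))%:E = \prod_j \int[law]_x (F j x)%:E.
  move=> mF F0 Foo; apply: (main N) => // j.
  by rewrite leqNgt ltn_ord.
elim: k => [_|k IH kN] {}F mF F0 Foo FA.
  have /choice[A AP] : forall j, exists A, measurable A /\ F j = \1_A.
    by move=> j; have [//|A mA FE] := FA j; exists A.
  transitivity (P (\bigcap_j (X j @^-1` A j))).
    rewrite -[X in P X]setIT -integral_indic//; last first.
      apply: fin_bigcap_measurable; first exact: finite_finset.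
      move=> j _; rewrite -[X in measurable X]setTI.
      by apply: mX => //; have [] := AP j.
    apply: eq_integral => t _; congr (_%:E).
    rewrite indicE; case: (boolP (_ \in _)) => [/set_mem h|/negP h].
      rewrite big1// => j _; have [_ ->] := AP j.
      by rewrite indicE mem_set//; exact: h.
    have [j hj] : exists j, ~ A j (X j t).
      apply: contrapT => /forallNP hn; apply: h; apply: mem_set => j _.
      by apply: contrapT; exact: hn.
    rewrite (bigD1 j)//=; have [_ ->] := AP j.
    by rewrite indicE memNset// mul0r.
  rewrite indX; last by move=> j; have [] := AP j.
  apply: eq_bigr => j _; have [mA ->] := AP j.
  by rewrite integral_indic// setIT lawX.
pose jk := Ordinal kN.
have fin j : \int[law]_x (F j x)%:E \is a fin_num.
  by rewrite ge0_fin_numE ?integral_ge0// => x _; rewrite lee_fin.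
pose c := (\prod_(j | j != jk) fine (\int[law]_x (F j x)%:E))%R.
have cE : c%:E = \prod_(j | j != jk) \int[law]_x (F j x)%:E.
  rewrite /c -prodEFin; apply: eq_bigr => j _.
  by rewrite fineK.
have c0 : (0 <= c)%R.
  apply: prodr_ge0 => j _; apply: fine_ge0; apply: integral_ge0 => x _.
  by rewrite lee_fin.
pose g t := (\prod_(j | j != jk) F j (X j t))%R.
under eq_integral => t _.
  rewrite (bigD1 jk)//= mulrC; over.
rewrite (bigD1 jk)//= -cE muleC.
apply: (@integral_weighted_comp _ _ _ _ _ P law g) => //.
- rewrite [g](_ : _ = fun t =>
      \prod_j (if j != jk then F j (X j t) else 1))%R; last first.
    by apply/funext => t; rewrite /g [LHS]big_mkcond.
  apply: measurable_prod => j _; case: (j != jk); last exact: measurable_cst.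
  exact: measurableT_comp.
- by move=> t; apply: prodr_ge0.
move=> A mA.
pose F' j := if j == jk then \1_A : T' -> R else F j.
transitivity (\int[P]_t (\prod_j F' j (X j t))%:E).
  apply: eq_integral => t _; congr (_%:E); rewrite (bigD1 jk)//= mulrC.
  congr (_ * _)%R; first by rewrite /F' eqxx.
  rewrite /g.
  by apply: eq_bigr => j /negbTE jk'; rewrite /F' jk'.
rewrite IH//.
- rewrite (bigD1 jk)//= muleC cE; congr (_ * _).
    by apply: eq_bigr => j /negbTE jk'; rewrite /F' jk'.
  by rewrite /F' eqxx integral_indic// setIT.
- exact: ltnW.
- by move=> j; rewrite /F'; case: ifP.
- by move=> j x; rewrite /F'; case: ifP.
- move=> j; rewrite /F'; case: ifP => // _.
  rewrite integral_indic// setIT; apply: le_lt_trans (probability_le1 _ mA) _.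
  exact: ltry.
- move=> j kj; rewrite /F'; case: eqP => [_|jk']; first by exists A.
  apply: FA; rewrite ltn_neqAle kj andbT; apply/eqP => kE; apply: jk'.
  exact: val_inj.
Qed.

End iid_product.

(** * One-sided deviations of empirical means *)

Section uniform_deviation.
Context d1 (T : measurableType d1) d2 (T' : measurableType d2) (R : realType).
Variables (P : probability T R) (law : probability T' R).
Variables (N : nat) (X : 'I_N -> T -> T').
Hypotheses (N_gt0 : (0 < N)%N) (iidX : iid P X law).

Lemma expRN_le_linear (y : R) : 0 <= y <= 1 -> expR (- y) <= 1 - y / 2.
Proof.
move=> /andP[y0 y1]; rewrite expRN.
have e1 : 1 + y <= expR y := expR_ge1Dx y.
have p : 0 < 1 + y by rewrite ltr_wpDr.
apply: le_trans (_ : (1 + y)^-1 <= _).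
  by rewrite lef_pV2 ?posrE ?expR_gt0.
rewrite -[_^-1]mul1r ler_pdivrMr//; nra.
Qed.

Variables (B : R) (W : T' -> R).
Hypotheses (B_gt0 : 0 < B) (mW : measurable_fun setT W).
Hypothesis W_itv : forall x, 0 <= W x <= B.

Definition empirical_mean (t : T) : R := N%:R^-1 * \sum_j W (X j t).

Let L : R := fine (\int[law]_x (W x)%:E).

Lemma mean_fineE : L%:E = (\int[law]_x (W x)%:E)%E.
Proof.
rewrite fineK// ge0_fin_numE; last first.
  by apply: integral_ge0 => x _; rewrite lee_fin; have /andP[] := W_itv x.
apply: (@le_lt_trans _ _ (\int[law]_x B%:E)%E).
  apply: ge0_le_integral => //.
  - by move=> x _; rewrite lee_fin; have /andP[] := W_itv x.
  - exact/measurable_EFinP.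
  - by move=> x _; rewrite lee_fin; have /andP[] := W_itv x.
rewrite integral_cst//= [X in (_ * X)%E](@probability_setT _ _ _ law).
by rewrite mule1 ltry.
Qed.

(** The bound [expRN_le_linear] turns the mean of [expR (- (W x / B))] into a
function of the mean of [W] alone.  By independence these factors multiply, and
with the exponent [N / (2 * B)] their product is cancelled by the factor that
comes from the mean. *)
Lemma exp_moment_le1 :
  (\int[P]_t (expR (N%:R / (2 * B) * (L - 2 * empirical_mean t)))%:E <= 1)%E.
Proof.
have Nn0 : N%:R != 0 :> R by rewrite pnatr_eq0 -lt0n.
have Bn0 : B != 0 by rewrite gt_eqF.
pose F x := expR (- (W x / B)).
have mF : measurable_fun setT F.
  apply: measurableT_comp => //; apply: measurableT_comp => //.
  exact: measurable_funM.
have WB x : 0 <= W x / B <= 1.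
  have /andP[w0 w1] := W_itv x.
  by rewrite divr_ge0 ?(ltW B_gt0)// ler_pdivrMr// mul1r.
have intF : (\int[law]_x (F x)%:E <= (expR (- (L / (2 * B))))%:E)%E.
  apply: (@le_trans _ _ (1 - L / (2 * B))%:E); last first.
    by rewrite lee_fin expR_ge1Dx.
  rewrite EFinB leeBrDr//.
  have -> : (L / (2 * B))%:E = (\int[law]_x (W x / B / 2)%:E)%E.
    under eq_integral do rewrite -mulrA -invfM mulrC EFinM.
    rewrite ge0_integralZl_EFin//.
    - by rewrite -mean_fineE -EFinM mulrC [B * 2]mulrC.
    - by move=> x _; rewrite lee_fin; have /andP[] := W_itv x.
    - exact/measurable_EFinP.
    - by rewrite invr_ge0 mulr_ge0// ltW.
  have mWB : measurable_fun setT (fun x => W x / B / 2).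
    by apply: measurable_funM => //; exact: measurable_funM.
  rewrite -ge0_integralD//.
  - apply: (@le_trans _ _ (\int[law]_x (cst 1%E) x)%E).
      apply: ge0_le_integral => //.
      + move=> x _; rewrite adde_ge0// lee_fin ?expR_ge0//.
        by rewrite divr_ge0//; have /andP[] := WB x.
      + by apply: emeasurable_funD; exact/measurable_EFinP.
      + move=> x _; rewrite -EFinD lee_fin -lerBrDr.
        exact: expRN_le_linear.
    by rewrite integral_cst//= [X in (_ * X)%E](@probability_setT _ _ _ law) mule1.
  - by move=> x _; rewrite lee_fin expR_ge0.
  - exact/measurable_EFinP.
  - by move=> x _; rewrite lee_fin divr_ge0//; have /andP[] := WB x.
  - exact/measurable_EFinP.
have prodE t : expR (N%:R / (2 * B) * (L - 2 * empirical_mean t)) =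
    expR (N%:R / (2 * B) * L) * \prod_j F (X j t).
  rewrite /F -expR_sum -expRD; congr expR.
  rewrite mulrBr sumrN -mulr_suml; congr (_ - _).
  by rewrite /empirical_mean; field; rewrite Nn0 Bn0.
under eq_integral do rewrite prodE EFinM.
have [mX _ _] := iidX.
rewrite ge0_integralZl_EFin//; first last.
- apply/measurable_EFinP; apply: measurable_prod => j _.
  exact: measurableT_comp.
- by move=> t _; rewrite lee_fin prodr_ge0// => j _; exact: expR_ge0.
rewrite (integral_prod_iid iidX (F := fun=> F))//; first last.
- by move=> _; apply: le_lt_trans intF _; exact: ltry.
- by move=> _ x; exact: expR_ge0.
have F_fin : (\int[law]_x (F x)%:E)%E \is a fin_num.
  rewrite ge0_fin_numE; first by apply: le_lt_trans intF _; exact: ltry.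
  by apply: integral_ge0 => x _; rewrite lee_fin expR_ge0.
rewrite -(fineK F_fin) in intF *; rewrite prodEFin -EFinM lee_fin.
rewrite lee_fin in intF; set r := fine _ in intF *.
have r0 : 0 <= r.
  by apply: fine_ge0; apply: integral_ge0 => x _; rewrite lee_fin expR_ge0.
rewrite prodr_const card_ord.
apply: le_trans (_ : expR (N%:R / (2 * B) * L) * expR (- (L / (2 * B))) ^+ N <= _).
  by rewrite ler_wpM2l ?expR_ge0// lerXn2r ?nnegrE ?expR_ge0.
rewrite -expRM_natl -expRD [X in expR X](_ : _ = 0) ?expR0//.
by field; rewrite Bn0.
Qed.

End uniform_deviation.

Section uniform_deviation_finite.
Context d1 (T : measurableType d1) d2 (T' : measurableType d2) (R : realType).
Variables (P : probability T R) (law : probability T' R).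
Variables (N : nat) (X : 'I_N -> T -> T').
Hypotheses (N_gt0 : (0 < N)%N) (iidX : iid P X law).
Variables (B : R) (I : finType) (W : I -> T' -> R).
Hypotheses (B_gt0 : 0 < B) (I_gt0 : (0 < #|I|)%N).
Hypothesis mW : forall i, measurable_fun setT (W i).
Hypothesis W_itv : forall i x, 0 <= W i x <= B.

(** Since [z <= expR z], the deviation of each member of the class is below the
sum of the exponentials of all the deviations, and each of these has mean at
most 1.  Splitting off [ln #|I|] before exponentiating makes the size of the
class enter through its logarithm only.  Comparing the mean with twice the
empirical mean is what gives the rate [1 / N] rather than its square root. *)
Lemma uniform_deviation : exists D : T -> R,
  [/\ measurable_fun setT D, forall t, 0 <= D t,
      (\int[P]_t (D t)%:E <= (2 * B / N%:R * (ln #|I|%:R + 1))%:E)%E &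
      forall i t, (\int[law]_x (W i x)%:E <=
                   (2 * empirical_mean X (W i) t + D t)%:E)%E].
Proof.
have Nn0 : N%:R != 0 :> R by rewrite pnatr_eq0 -lt0n.
have Ngt0 : 0 < N%:R :> R by rewrite ltr0n.
have [mX _ _] := iidX.
pose s := N%:R / (2 * B).
have s0 : 0 < s by rewrite divr_gt0// mulr_gt0.
have sE : s^-1 = 2 * B / N%:R by rewrite /s invf_div.
pose y0 := s^-1 * ln #|I|%:R.
have y00 : 0 <= y0.
  by apply: mulr_ge0; [rewrite invr_ge0 ltW|apply: ln_ge0; rewrite ler1n].
pose L i := fine (\int[law]_x (W i x)%:E)%E.
pose Y i t := expR (s * (L i - 2 * empirical_mean X (W i) t)).
pose D t := y0 + s^-1 * (#|I|%:R^-1 * \sum_i Y i t).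
have mY i : measurable_fun setT (Y i).
  apply: measurableT_comp => //; apply: measurable_funM => //.
  apply: measurable_funB => //; apply: measurable_funM => //.
  rewrite /empirical_mean; apply: measurable_funM => //.
  by apply: measurable_sum => j; exact: measurableT_comp.
have Y0 i t : 0 <= Y i t by exact: expR_ge0.
have mD0 : measurable_fun setT (fun t => s^-1 * (#|I|%:R^-1 * \sum_i Y i t)).
  apply: measurable_funM => //; apply: measurable_funM => //.
  exact: measurable_sum.
have mD : measurable_fun setT D by exact: measurable_funD.
have I0 : 0 < #|I|%:R :> R by rewrite ltr0n.
have D00 t : 0 <= s^-1 * (#|I|%:R^-1 * \sum_i Y i t).
  apply: mulr_ge0; first by rewrite invr_ge0 ltW.
  by apply: mulr_ge0; rewrite ?invr_ge0// sumr_ge0.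
exists D; split => //.
- by move=> t; rewrite addr_ge0.
- under eq_integral do rewrite /D EFinD.
  rewrite ge0_integralD//; last 2 first.
  + by move=> t _; rewrite lee_fin.
  + exact/measurable_EFinP.
  rewrite integral_cst// [X in (_ * X)%E](@probability_setT _ _ _ P) mule1.
  rewrite -sE mulrDr mulr1 [leRHS]EFinD leeD//.
  under eq_integral do rewrite mulrA EFinM.
  rewrite ge0_integralZl_EFin//; first last.
  + by rewrite divr_ge0// invr_ge0 ltW.
  + by apply/measurable_EFinP; exact: measurable_sum.
  + by move=> t _; rewrite lee_fin sumr_ge0.
  under eq_integral do rewrite -sumEFin.
  rewrite ge0_integral_sum//; last 2 first.
  + by move=> i; exact/measurable_EFinP.
  + by move=> i t _; rewrite lee_fin.
  apply: (@le_trans _ _ ((s^-1 / #|I|%:R)%:E * \sum_(i : I) 1%E)%E).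
    apply: lee_wpmul2l; first by rewrite lee_fin divr_ge0 ?invr_ge0 ?ltW.
    apply: lee_sum => i _.
    exact: (exp_moment_le1 N_gt0 iidX B_gt0 (mW i) (W_itv i)).
  by rewrite sumEFin sumr_const -EFinM lee_fin -mulrA mulVf ?mulr1// gt_eqF.
- move=> i t; rewrite -(mean_fineE law (mW i) (W_itv i)) lee_fin -/(L i).
  rewrite addrC -lerBlDr; set Z := L i - _.
  apply: le_trans (_ : y0 + s^-1 * (#|I|%:R^-1 * Y i t) <= _); last first.
    rewrite lerD2l; apply: ler_wpM2l; first by rewrite invr_ge0 ltW.
    apply: ler_wpM2l; first by rewrite invr_ge0.
    by rewrite (bigD1 i)//= lerDl sumr_ge0.
  rewrite -lerBlDl -ler_pdivrMl ?invr_gt0// invrK mulrBr /y0 mulrA.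
  rewrite mulfV ?gt_eqF// mul1r.
  have -> : #|I|%:R^-1 * Y i t = expR (s * Z - ln #|I|%:R).
    by rewrite expRD expRN lnK ?posrE// mulrC.
  by apply: le_trans (expR_ge1Dx _); rewrite lerDr.
Qed.

End uniform_deviation_finite.

(** * Traces and pure derivatives *)

Section traces.
Variables (R : realType) (d : nat).
Local Notation E := 'rV[R]_d.
Implicit Types (D : set E) (f g : E -> R) (x : E) (s : seq 'I_d).

(** A bound on [f - g] inside [D] survives at an adherent point, where [g] only
has a trace. *)
Lemma trace_dist_le D f g x (K : R) :
  closure D x -> cvg (g @ within D (nbhs x)) ->
  {for x, continuous f} -> (forall y, D y -> `|f y - g y| <= K) ->
  `|f x - trace D g x| <= K.
Proof.
move=> Dx cg cf fgK.
have pf : ProperFilter (within D (nbhs x)) by exact: within_nbhs_proper.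
have cf' : f @ within D (nbhs x) --> f x.
  by apply: cvg_trans cf; apply: cvg_app; exact: cvg_within.
have h : (fun y => `|f y - g y|) @ within D (nbhs x) --> `|f x - trace D g x|.
  by apply: cvg_norm; apply: cvgB.
rewrite -(cvg_lim _ h)//; apply: limr_le; first by apply/cvg_ex; eexists; exact: h.
exact: (@nearW _ (nbhs x) (fun y => D y -> `|f y - g y| <= K)).
Qed.

Lemma trace_interior D g x : open D -> D x -> {for x, continuous g} ->
  trace D g x = g x.
Proof.
move=> oD Dx cg; have pf : ProperFilter (within D (nbhs x)).
  by apply: within_nbhs_proper; exact: subset_closure.
apply: cvg_lim => //; apply: cvg_trans cg; apply: cvg_app.
exact: cvg_within.
Qed.

Lemma bounded_set_closure D : bounded_set D -> bounded_set (closure D).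
Proof.
move=> [M [Mr DM]]; exists M; split=> // N MN.
have cN : closed [set y : E | `|y| <= N].
  rewrite (_ : [set y : E | _] = Num.norm @^-1` [set r | r <= N])//.
  by apply: closed_comp; [move=> y _; exact: norm_continuous|exact: closed_le].
have : closure D `<=` [set y : E | `|y| <= N].
  by rewrite [X in _ `<=` X](closure_id _).1//; apply: closure_subset; exact: DM.
by [].
Qed.

(** Near each adherent point the derivative has a limit, hence a local bound;
compactness of the closure makes the bound uniform. *)
Lemma Ck_closure_bounded k D f s : bounded_set D -> Ck_closure k D f ->
  (size s <= k)%N -> exists K : R, forall x, D x -> `|pds s f x| <= K.
Proof.
move=> bD [_ cD] sk.
have cpt : compact (closure D).
  apply: bounded_closed_compact; last exact: closed_closure.
  exact: bounded_set_closure.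
move/compact_near_coveringP : cpt => /(_ _ (pinfty_nbhs R)
  (fun K x => D x -> `|pds s f x| <= K) _).
case.
  move=> x Dx; have := cD s sk x Dx => /cvg_ex[l /= cl].
  have bl : \forall y \near within D (nbhs x), `|pds s f y| < `|l| + 1.
    by apply: (cvgr_norm_lt _ cl); rewrite ltrDl.
  exists ([set y | D y -> `|pds s f y| < `|l| + 1], [set K | `|l| + 1 < K]).
    by split => //=; exact: nbhs_pinfty_gt.
  by move=> [y K] /= [h1 h2] Dy; apply/ltW/(lt_trans _ h2)/h1.
move=> K0 [_ /(_ (K0 + 1))]; rewrite ltrDl => /(_ ltr01) h.
by exists (K0 + 1) => x Dx; apply: h => //; exact: subset_closure.
Qed.

Lemma pdsB k D f g s : open D -> Ck_on k D g ->
  (forall s i x, derivable (pds s f) x (delta_mx 0 i : E)) -> (size s <= k)%N ->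
  forall x, D x -> pds s (fun y => f y - g y) x = pds s f x - pds s g x.
Proof.
move=> oD cg df; elim: s => [//|i s IH] /= sk x Dx.
rewrite /pd (@near_eq_derive _ _ _ _ (pds s f - pds s g)); last first.
  near=> y; rewrite IH; [by []|exact: ltnW|].
  by near: y; exact: open_nbhs_nbhs.
have [_ /(_ sk i x Dx) dg] := cg s (ltnW sk).
exact: (deriveB (df s i x) dg).
Unshelve. all: by end_near. Qed.

(** The C2 norm only controls the mixed derivatives with [i <= j], so the
pure derivatives are singled out: they are those along a constant sequence of
directions, and they suffice for the Laplacian, the gradient and the value. *)
Lemma C2_norm_pds D f (K : R) s x : D !=set0 -> (C2_norm D f <= K%:E)%E ->
  constant s -> (size s <= 2)%N -> D x -> `|pds s f x| <= K.
Proof.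
move=> [x0 Dx0] fK cs s2 Dx.
have sup_ge0 g : (0 <= sup_abs D g)%E.
  apply: (@le_trans _ _ `|g x0|%:E); first by rewrite lee_fin.
  by apply: ereal_sup_ubound; exists x0.
have ge1 : (0 <= \sum_(i < d) sup_abs D (pd i f))%E by exact: sume_ge0.
have ge2' (i : 'I_d) :
    (0 <= \sum_(j < d | (i <= j)%N) sup_abs D (pds [:: i; j] f))%E.
  exact: sume_ge0.
have ge2 : (0 <= \sum_(i < d) \sum_(j < d | (i <= j)%N)
    sup_abs D (pds [:: i; j] f))%E.
  by apply: sume_ge0 => i _; exact: ge2'.
rewrite -lee_fin; apply: le_trans fK.
apply: (@le_trans _ _ (sup_abs D (pds s f))).
  by apply: ereal_sup_ubound; exists x.
rewrite /C2_norm; case: s cs s2 => [|i [|j [|//]]] + _.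
- by move=> _; rewrite -addeA leeDl// adde_ge0.
- move=> _; apply: (le_trans (lee_sum_term (F := fun i => sup_abs D (pd i f))
    (isT : xpredT i) (fun=> sup_ge0 _))).
  by rewrite addeAC leeDr// adde_ge0.
- rewrite [constant _]/= andbT => /eqP ->.
  have h1 := @lee_sum_term R _ (fun j : 'I_d => (i <= j)%N)
    (fun j => sup_abs D (pds [:: i; j] f)) i (leqnn i) (fun=> sup_ge0 _).
  have h2 := @lee_sum_term R _ xpredT (fun k : 'I_d =>
    \sum_(j < d | (k <= j)%N) sup_abs D (pds [:: k; j] f))%E i isT ge2'.
  apply: (le_trans h1); apply: (le_trans h2).
  by rewrite leeDr// adde_ge0.
Qed.

End traces.

(** * Geometry of the interface *)

Section geometry.
Variables (R : realType) (d : nat) (pb : interface_problem R d).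
Local Notation E := 'rV[R]_d.
Hypothesis geometry : interface_geometry pb.
Implicit Types (x y : E).

Lemma open_subdomain i : open (subdomain pb i).
Proof.
have [[oO _ _] [oO1 _ _] _ _ _] := geometry.
rewrite /subdomain; case: ifP => // _; rewrite /Omega2 setDE.
by apply: openI => //; rewrite openC; exact: closed_closure.
Qed.

Lemma subdomain_sub i : subdomain pb i `<=` Omega pb.
Proof.
have [_ [_ _ cO] _ _ _] := geometry.
rewrite /subdomain; case: ifP => _; last by move=> x [].
by move=> x O1x; apply: cO; exact: subset_closure.
Qed.

(** Moving from a point of the interface in a coordinate direction along which
the level-set function has a nonzero derivative makes this function positive,
which leads into the exterior subdomain. *)
Lemma Gamma_adherent_Omega2 : Gamma pb `<=` closure (Omega2 pb).
Proof.
move=> x Gx; have [_ _ /(_ x Gx)[V [phi [oV Vx cphi gphi signs]]] _ _] := geometry.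
have [i gi] : exists i, pd i phi x != 0.
  apply: contrapT => /forallNP h; move/negP: gphi; apply; apply/eqP/rowP => i.
  by rewrite !mxE; apply/eqP/negPn/negP; exact: h.
have phix : phi x = 0 by have [_ [h _] _] := signs x Vx; exact: h.
have [_ /(_ isT i x Vx) dphi] := cphi [::] isT.
pose q (h : R) := h^-1 *: ((phi \o shift x) (h *: (delta_mx 0 i : E)) - phi x).
have cq : q @ 0^' --> pd i phi x := dphi.
move=> B Bx.
have cl : {for (0 : R), continuous (fun h : R => h *: (delta_mx 0 i : E) + x)}.
  by apply: cvgD; [exact: scalel_continuous|exact: cvg_cst].
have BV : \forall h \near (0 : R)^', (B `&` V) (h *: (delta_mx 0 i : E) + x).
  apply: cvg_within; apply: cl; rewrite scale0r add0r.
  by apply: filterI => //; exact: open_nbhs_nbhs.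
suff [h [[Bh Vh] ph]] : exists h : R, (B `&` V) (h *: (delta_mx 0 i : E) + x) /\
    0 < phi (h *: (delta_mx 0 i : E) + x).
  exists (h *: (delta_mx 0 i : E) + x); split => //.
  by have [_ _ sign2] := signs _ Vh; apply/sign2.
have [g0|g0] := ltP 0 (pd i phi x).
  have /nbhs_ballP[e /= e0 he] : nbhs (0 : R) (fun h => h != 0 ->
    (B `&` V) (h *: (delta_mx 0 i : E) + x) /\ 0 < q h).
    exact: (filterI BV (cvgr_gt _ cq 0 g0)).
  exists (e / 2).
  have e2 : 0 < e / 2 by rewrite divr_gt0.
  have [||BVh] := he (e / 2).
  - by rewrite /ball/= sub0r normrN gtr0_norm// ltr_pdivrMr// ltr_pMr// ltr1n.
  - by rewrite gt_eqF.
  - by rewrite /q /= phix subr0 /GRing.scale/= pmulr_rgt0 ?invr_gt0.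
have {}g0 : pd i phi x < 0 by rewrite lt_neqAle gi.
have /nbhs_ballP[e /= e0 he] : nbhs (0 : R) (fun h => h != 0 ->
    (B `&` V) (h *: (delta_mx 0 i : E) + x) /\ q h < 0).
  exact: (filterI BV (cvgr_lt _ cq 0 g0)).
exists (- (e / 2)).
have e2 : 0 < e / 2 by rewrite divr_gt0.
have [||BVh] := he (- (e / 2)).
- by rewrite /ball/= sub0r opprK gtr0_norm// ltr_pdivrMr// ltr_pMr// ltr1n.
- by rewrite oppr_eq0 gt_eqF.
- by rewrite /q /= phix subr0 /GRing.scale/= nmulr_rlt0 ?invr_lt0 ?oppr_lt0.
Qed.

Lemma bdOmega_adherent_Omega2 : bdOmega pb `<=` closure (Omega2 pb).
Proof.
have [_ [_ _ cO] _ _ _] := geometry.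
move=> x [cx nx] B Bx.
have nB : nbhs x (B `&` ~` closure (Omega1 pb)).
  apply: filterI => //; apply: open_nbhs_nbhs; split; last by move/cO.
  by rewrite openC; exact: closed_closure.
by have [y [Oy [By nO1]]] := cx _ nB; exists y.
Qed.

(** The subdomains from which the loss on site [k] takes values or derivatives. *)
Definition touches (k : 'I_5) (i : 'I_2) : bool :=
  match val k with
  | 0 => i == 0
  | 1 | 4 => i == 1
  | _ => true
  end.

Lemma site_adherent k i x : touches k i -> site pb k x ->
  closure (subdomain pb i) x.
Proof.
case: k i => -[|[|[|[|[|//]]]]] k5 [[|[|//]] i2]; rewrite /touches /site /subdomain //= => _.
- exact: subset_closure.
- exact: subset_closure.
- by case.
- exact: Gamma_adherent_Omega2.
- by case.
- exact: Gamma_adherent_Omega2.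
- exact: bdOmega_adherent_Omega2.
Qed.

Lemma site_closure k : site pb k `<=` closure (Omega pb).
Proof.
move=> x sx; have [i ti] : exists i, touches k i.
  case: k sx => -[|[|[|[|[|//]]]]] k5 _;
    by [exists 0|exists 1].
by apply: closure_subset (site_adherent ti sx); exact: subdomain_sub.
Qed.

Lemma measurable_site k : measurable (site pb k).
Proof.
have [[oO _ _] [oO1 _ _] _ _ _] := geometry.
have mO := open_measurable_rV oO; have mO1 := open_measurable_rV oO1.
have mc (A : set E) : measurable (closure A).
  by apply: closed_measurable_rV; exact: closed_closure.
case: k => -[|[|[|[|[|//]]]]] k5; rewrite /site //=; exact: measurableD.
Qed.

End geometry.

(** * The residual of the interface problem *)

Section residual.
Variables (R : realType) (d : nat) (pb : interface_problem R d).
Local Notation E := 'rV[R]_d.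
Hypothesis geometry : interface_geometry pb.
Implicit Types (x y : E) (k : 'I_5).

Lemma normr_normal_le1 x i : Gamma pb x -> `|normal pb x 0 i| <= 1.
Proof.
have [_ _ level normalE _] := geometry.
move=> Gx; have [V [phi le]] := level x Gx.
rewrite (normalE x V phi Gx le) mxE normrM.
set g := grad phi x.
rewrite ger0_norm ?invr_ge0 ?norm2_ge0// mulrC.
have [->|g0] := eqVneq (norm2 g) 0; first by rewrite invr0 mulr0.
rewrite ler_pdivrMr ?mul1r ?ler_coord_norm2//.
by rewrite lt_neqAle eq_sym g0 norm2_ge0.
Qed.

(** Near a point of the interface the normal is the normalised gradient of one
level-set function, so it is continuous along the interface. *)
Lemma measurable_normal i : measurable_fun (Gamma pb) (fun x => normal pb x 0 i).
Proof.
have [_ _ level normalE _] := geometry.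
apply: within_continuous_measurable_rV.
  exact: (measurable_site geometry (@Ordinal 5 2 isT)).
move=> x Gx; have [V [phi lx]] := level x Gx.
have [oV Vx cphi gphi signs] := lx.
pose G y := (norm2 (grad phi y))^-1 * pd i phi y.
have cpd j : {for x, continuous (pd j phi)}.
  by have [h _] := cphi [:: j] isT; exact: h.
have norm2E : (fun y => norm2 (grad phi y)) =
    Num.sqrt \o (fun y => \sum_j pd j phi y ^+ 2).
  apply/funext => y; rewrite /norm2/=; congr (Num.sqrt _).
  by apply: eq_bigr => j _; rewrite mxE.
have cn : {for x, continuous (fun y => norm2 (grad phi y))}.
  rewrite norm2E; apply: continuous_comp; last exact: sqrt_continuous.
  apply: (@cvg_fin_sum R E (nbhs x)) => j.
  by under eq_fun do rewrite expr2; rewrite expr2; apply: cvgM; exact: cpd.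
have n0 : 0 < norm2 (grad phi x).
  rewrite lt_neqAle norm2_ge0 andbT eq_sym; apply: contra gphi => /eqP n0.
  apply/eqP/rowP => j; apply/eqP; rewrite !mxE -normr_le0 -n0.
  by have := ler_coord_norm2 (grad phi x) j; rewrite mxE.
have cG : {for x, continuous G}.
  exact: (cvgM (cvgV (lt0r_neq0 n0) cn) (cpd i)).
have nG y : Gamma pb y -> V y -> 0 < norm2 (grad phi y) -> normal pb y 0 i = G y.
  move=> Gy Vy ny; rewrite (normalE y V phi Gy) ?mxE//; split => //.
  apply/eqP => g0; move: ny; rewrite g0 /norm2 big1 ?sqrtr0 ?ltxx// => j _.
  by rewrite mxE expr0n.
have -> : normal pb x 0 i = G x by exact: nG.
apply: cvg_trans (_ : G @ within (Gamma pb) (nbhs x) `=>` _); last first.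
  by apply: cvg_trans cG; apply: cvg_app; exact: cvg_within.
apply: near_eq_cvg.
have nV : \forall y \near x, V y by exact: open_nbhs_nbhs.
have nN : \forall y \near x, 0 < norm2 (grad phi y) by exact: cvgr_gt cn _ n0.
apply: filterS2 nV nN => y Vy ny Gy.
by rewrite nG.
Qed.

(** The operator of the interface problem on site [k], as a linear form in the
values [J i s] of the derivatives along [s] on the [i]-th subdomain.  The loss
is the square of this form at the difference between a network and the exact
solution. *)
Definition jet_residual (J : 'I_2 -> seq 'I_d -> R) k x : R :=
  match val k with
  | 0 => beta pb 0 * \sum_i J 0 [:: i; i]
  | 1 => beta pb 1 * \sum_i J 1 [:: i; i]
  | 2 => \sum_i (beta pb 1 * J 1 [:: i] - beta pb 0 * J 0 [:: i]) *
                normal pb x 0 i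
  | 3 => J 1 [::] - J 0 [::]
  | _ => J 1 [::]
  end.

Definition residual_cst : R := d%:R * (beta pb 0 + beta pb 1) + 2.

Lemma jet_residualB J J' k x :
  jet_residual J k x - jet_residual J' k x = jet_residual (fun i s => J i s - J' i s) k x.
Proof.
case: k => -[|[|[|[|[|//]]]]] k5; rewrite /jet_residual /=.
- by rewrite -mulrBr -sumrB.
- by rewrite -mulrBr -sumrB.
- by rewrite -sumrB; apply: eq_bigr => i _; ring.
- by ring.
- by [].
Qed.

(** Only pure derivatives ([constant s]) and the subdomains adjacent to the site
enter the form. *)
Lemma jet_residual_bound J k x (K : R) : 0 <= K -> site pb k x ->
  (forall i s, touches k i -> constant s -> (size s <= 2)%N -> `|J i s| <= K) ->
  `|jet_residual J k x| <= residual_cst * K.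
Proof.
have [_ _ _ _ beta_gt0] := geometry.
have b0 := ltW (beta_gt0 0); have b1 := ltW (beta_gt0 1).
move=> K0 sx JK.
have p0 : 0 <= d%:R * beta pb 0 * K by rewrite !mulr_ge0.
have p1 : 0 <= d%:R * beta pb 1 * K by rewrite !mulr_ge0.
have lapB i : touches k i ->
    `|beta pb i * \sum_j J i [:: j; j]| <= d%:R * beta pb i * K.
  move=> ti; rewrite normrM (gtr0_norm (beta_gt0 i)) [d%:R * _]mulrC -mulrA.
  apply: ler_wpM2l; first exact: ltW.
  apply: le_trans (ler_norm_sum _ _ _) _.
  apply: le_trans (_ : \sum_(j < d) K <= _).
    by apply: ler_sum => j _; apply: JK => //=; rewrite eqxx.
  by rewrite sumr_const card_ord mulr_natl.
rewrite /residual_cst.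
case: k sx JK lapB => -[|[|[|[|[|//]]]]] k5;
  rewrite /jet_residual /site /= => sx JK lapB.
- apply: le_trans (lapB 0 isT) _; nra.
- apply: le_trans (lapB 1 isT) _; nra.
- apply: le_trans (ler_norm_sum _ _ _) _.
  apply: le_trans (_ : \sum_(i < d) (beta pb 0 + beta pb 1) * K <= _).
    apply: ler_sum => i _; rewrite normrM.
    apply: le_trans (_ : ((beta pb 0 + beta pb 1) * K) * 1 <= _); last by rewrite mulr1.
    apply: ler_pM => //; last exact: normr_normal_le1.
    apply: le_trans (ler_normB _ _) _; rewrite !normrM !(gtr0_norm (beta_gt0 _)).
    by rewrite addrC mulrDl; apply: lerD; apply: ler_wpM2l => //; exact: JK.
  by rewrite sumr_const card_ord -[_ *+ d]mulr_natl; nra.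
- have h0 := JK 0 [::] isT isT isT; have h1 := JK 1 [::] isT isT isT.
  apply: le_trans (ler_normB _ _) _; nra.
- have h1 := JK 1 [::] isT isT isT.
  apply: le_trans h1 _; nra.
Qed.

End residual.

(** * Residuals of networks *)

Section network_residual.
Variables (R : realType) (d : nat) (pb : interface_problem R d).
Local Notation E := 'rV[R]_d.
Local Notation param := 'rV[R]_(d + 1).
Hypothesis geometry : interface_geometry pb.
Variables (U : 'I_5 -> probability E R).
Hypothesis uniform :
  forall k, uniform_on (@site_measure R d k) (site pb k) (U k).
Hypothesis regularity : data_regularity pb U.
Variable v : E -> R.
Hypothesis solution : exact_solution pb v.

Lemma subdomain_nonempty i : subdomain pb i !=set0.
Proof.
apply/set0P/eqP => s0.
have [k kE] : exists k : 'I_5, (k < 2)%N /\ site pb k = subdomain pb i.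
  case: i s0 => -[|[|//]] i2 _.
    by exists (@Ordinal 5 0 isT).
  by exists (@Ordinal 5 1 isT).
have [] := uniform k; rewrite kE.2 s0 /site_measure kE.1.
by rewrite measure0 ltxx.
Qed.

(** The definition of the uniform law at the site itself says that its mass times
the measure of the site is that measure, which is finite and nonzero. *)
Lemma uniform_site1 k : U k (site pb k) = 1%E.
Proof.
have [mu0 muoo h] := uniform k.
have := h _ (measurable_site geometry k); rewrite setIid.
set m := site_measure _ _ in mu0 muoo *.
have mfin : m \is a fin_num by rewrite ge0_fin_numE// ltW.
rewrite -(fineK mfin); have f0 : fine m != 0.
  by rewrite gt_eqF// fine_gt0// mu0.
move/(congr1 (fun z => (z * (fine m)^-1%:E)%E)).
by rewrite -muleA -!EFinM mulfV// mule1.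
Qed.

(** Only finitely many pure derivatives are concerned, so their bounds can be
added up.  A positive dimension provides a direction that represents the empty
sequence as one of the sequences [nseq n j]. *)
Lemma trace_solution_bounded : (0 < d)%N -> exists2 K : R, 0 <= K &
  forall i s x, constant s -> (size s <= 2)%N -> closure (subdomain pb i) x ->
    `|trace (subdomain pb i) (pds s v) x| <= K.
Proof.
move=> d_gt0; have [[_ _ bO] _ _ _ _] := geometry.
have [[svC _] _ _ _ _] := solution.
have bS i : bounded_set (subdomain pb i).
  have [N [Nr ON]] := bO; exists N; split=> // L NL x Sx.
  exact: ON NL _ (subdomain_sub geometry Sx).
have bnd i s : exists K : R, (size s <= 2)%N ->
    forall x, subdomain pb i x -> `|pds s v x| <= K.
  have [s2|_] := leqP (size s) 2; last by exists 0.
  by have [K vK] := Ck_closure_bounded (bS i) (svC i).2 s2; exists K.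
have /choice[K vK] : forall i, exists K : seq 'I_d -> R, forall s,
    (size s <= 2)%N -> forall x, subdomain pb i x -> `|pds s v x| <= K s.
  by move=> i; have /choice[K vK] := bnd i; exists K.
pose B := \sum_(z : 'I_2 * 'I_3 * 'I_d) `|K z.1.1 (nseq z.1.2 z.2)|.
exists B; first exact: sumr_ge0.
move=> i s x /constantP-/(_ (Ordinal d_gt0))[j sE] s2 clx.
rewrite -normrN -sub0r; apply: (@trace_dist_le R d _ (cst 0)) => //.
- by have [_ [_ h]] := svC i; exact: h.
- exact: cst_continuous.
move=> y Dy; rewrite sub0r normrN; apply: le_trans (vK i s s2 y Dy) _.
apply: le_trans (ler_norm _) _; rewrite sE.
by rewrite /B (bigD1 (i, @Ordinal 3 (size s) s2, j))//= lerDl sumr_ge0.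
Qed.

Variables (r : R) (r_ge0 : 0 <= r).
Hypothesis Omega_r : forall x, closure (Omega pb) x -> forall j, `|x 0 j| <= r.

Variables (q : R) (q_gt0 : 0 < q) (M : nat) (th : 'I_2 -> 'I_M -> param).
Hypothesis th_cube : forall i m, cube q (th i m).
Implicit Types a b : 'I_2 -> 'I_M -> R.

(** The exact solution enters through its traces, which make sense on all sites
and agree with its derivatives inside the subdomains. *)
Definition residual a k x : R :=
  jet_residual pb (fun i s => rannD (th i) s (a i) x -
                         trace (subdomain pb i) (pds s v) x) k x.

(** The data of the problem are the images of the exact solution, so they can be
replaced by its derivatives and traces. *)
Lemma loss_termE a k x : site pb k x ->
  loss_term pb (rann_pair th a) k x = residual a k x ^+ 2.
Proof.
have [[svC _] pde gNE gDE gBE] := solution.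
have traceE i s y : (size s <= 2)%N -> subdomain pb i y ->
    trace (subdomain pb i) (pds s v) y = pds s v y.
  move=> s2 Dy; apply: trace_interior => //; first exact: open_subdomain.
  by have [_ [h _]] := svC i; have [h1 _] := h s s2; exact: h1.
have s0E : subdomain pb 0 = Omega1 pb by [].
have s1E : subdomain pb 1 = Omega2 pb by [].
have rE i s y : pds s (rann_pair th a i) y = rannD (th i) s (a i) y.
  by rewrite /rann_pair pds_rann.
have lapE i y : subdomain pb i y ->
   (beta pb i * laplacian (rann_pair th a i) y + src pb y) =
   beta pb i * \sum_j (rannD (th i) [:: j; j] (a i) y -
      trace (subdomain pb i) (pds [:: j; j] v) y).
  move=> Dy; rewrite -(pde i y Dy) -mulrBr /laplacian -sumrB; congr (_ * _).
  by apply: eq_bigr => j _; rewrite rE traceE.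
case: k => -[|[|[|[|[|//]]]]] k5;
  rewrite /site /loss_term /residual /jet_residual /= => sx.
- by rewrite -lapE.
- by rewrite -lapE.
- rewrite -(gNE x sx) /dot -sumrB; congr (_ ^+ 2); apply: eq_bigr => i _.
  rewrite !mxE -!(rE _ [:: i]) s0E s1E /=; ring.
- by rewrite -(gDE x sx) -!(rE _ [::]) /=; congr (_ ^+ 2); ring.
- by rewrite -(gBE x sx) -!(rE _ [::]) /=.
Qed.

(** Gives the approximation error: the residual of a network is controlled by its
C2 distance to the exact solution. *)
Lemma residual_le_C2_norm a k x (K : R) : 0 <= K -> site pb k x ->
  (forall i, (C2_norm (subdomain pb i)
                (fun y => (rann_pair th a i y - v y)%R) <= K%:E)%E) ->
  `|residual a k x| <= residual_cst pb * K.
Proof.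
have [[svC _] _ _ _ _] := solution.
move=> K0 sx aK; apply: jet_residual_bound => // i s ti cs s2.
have clx := site_adherent geometry ti sx.
rewrite -pds_rann; apply: trace_dist_le => //.
- by have [_ [_ h]] := svC i; exact: h.
- by rewrite pds_rann; exact: continuous_rannD.
move=> y Dy; have [_ [cv _]] := svC i.
rewrite -(pdsB (open_subdomain geometry (i := i)) cv _ s2 Dy); last first.
  by move=> *; exact: derivable_pds_rann.
exact: C2_norm_pds (subdomain_nonempty i) (aK i) cs s2 Dy.
Qed.

Lemma residual_lipschitz a b k x (W : R) : 0 <= W -> site pb k x ->
  (forall i, wnorm1 (th i) (fun m => a i m - b i m) <= W) ->
  `|residual a k x - residual b k x| <=
  residual_cst pb * ((2 + d%:R * r) * Num.min 1 q * W).
Proof.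
move=> W0 sx abW; rewrite jet_residualB.
have kap0 : 0 <= Num.min 1 q by rewrite le_min ler01 ltW.
have c0 : 0 <= 2 + d%:R * r by rewrite addr_ge0// mulr_ge0.
apply: jet_residual_bound => //; first by rewrite !mulr_ge0.
move=> i s ti cs s2.
have -> : forall A B C : R, A - C - (B - C) = A - B by move=> *; ring.
rewrite rannDB.
have xr := Omega_r (site_closure geometry sx).
apply: le_trans (rannD_bound q_gt0 r_ge0 (th_cube i) _ s2 xr) _.
by apply: ler_wpM2l => //; exact: mulr_ge0.
Qed.

Lemma residual_bound a k x (K CB : R) : 0 <= K -> site pb k x ->
  (forall i s x, constant s -> (size s <= 2)%N -> closure (subdomain pb i) x ->
    `|trace (subdomain pb i) (pds s v) x| <= K) ->
  coefficients th CB a ->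
  `|residual a k x| <= residual_cst pb * (K + (2 + d%:R * r) * CB).
Proof.
move=> K0 sx vK aCB.
have xr := Omega_r (site_closure geometry sx).
have c0 : 0 <= 2 + d%:R * r by rewrite addr_ge0// mulr_ge0.
have CB0 : 0 <= CB.
  by apply: le_trans (aCB 0); apply: sumr_ge0 => m _; rewrite mulr_ge0// sqr_ge0.
apply: jet_residual_bound => //; first by rewrite addr_ge0// mulr_ge0.
move=> i s ti cs s2; apply: le_trans (ler_normB _ _) _; rewrite addrC lerD//.
  by apply: vK => //; exact: site_adherent sx.
apply: le_trans (rannD_bound q_gt0 r_ge0 (th_cube i) _ s2 xr) _.
rewrite -mulrA; apply: ler_wpM2l => //.
rewrite -[leRHS]mul1r; apply: ler_pM.
- by rewrite le_min ler01 ltW.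
- by apply: sumr_ge0 => m _; rewrite mulr_ge0// sqr_ge0.
- by rewrite ge_min lexx.
- exact: aCB.
Qed.

(** The data on the interface and on the boundary are measurable as traces of
Sobolev functions. *)
Lemma measurable_loss a k :
  measurable_fun (site pb k) (loss_term pb (rann_pair th a) k).
Proof.
have [[[mg _] _] [[w1 [p1 [_ _ mN _]]] _] [[w2 [p2 [_ _ mD _]]] _]
  [[w3 [p3 [_ _ mB _]]] _]] := regularity.
have mr D i s : measurable_fun D (pds s (rann_pair th a i)).
  apply: measurable_funS (continuous_measurable_rV _) => //.
  by rewrite /rann_pair pds_rann; exact: continuous_rannD.
have [oO oO1] : open (Omega pb) /\ open (Omega1 pb).
  by have [[oO _ _] [oO1 _ _] _ _ _] := geometry.
have mlap D i : measurable_fun D (laplacian (rann_pair th a i)).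
  by apply: measurable_sum => j; exact: mr.
have msrc D : D `<=` Omega pb -> measurable_fun D (src pb).
  by move=> DO; apply: measurable_funS mg => //; exact: open_measurable_rV.
case: k => -[|[|[|[|[|//]]]]] k5; rewrite /site /loss_term /=;
  apply: measurable_funX.
- apply: measurable_funD; last by apply: msrc; exact: (@subdomain_sub _ _ _ geometry 0).
  exact: measurable_funM.
- apply: measurable_funD; last by apply: msrc; exact: (@subdomain_sub _ _ _ geometry 1).
  exact: measurable_funM.
- apply: measurable_funB; last exact: mN.
  apply: measurable_sum => i; apply: measurable_funM; last exact: measurable_normal.
  under eq_fun do rewrite !mxE.
  by apply: measurable_funB; apply: measurable_funM => //; exact: (mr _ _ [:: i]).
- apply: measurable_funB; last exact: mD.
  by apply: measurable_funB; exact: (mr _ _ [::]).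
- apply: measurable_funB; last exact: mB.
  exact: (mr _ _ [::]).
Qed.

End network_residual.

(** * A finite net of coefficients *)

Section covering.
Variables (R : realType) (d M : nat).
Local Notation param := 'rV[R]_(d + 1).
Variables (th : 'I_2 -> 'I_M -> param) (CB : R) (L : nat).
Hypothesis L_gt0 : (0 < L)%N.

Let w i m : R := (1 + norm2 (weight (th i m))) ^+ 2.

Let w_gt0 i m : 0 < w i m.
Proof. by rewrite exprn_gt0// ltr_pwDl// norm2_ge0. Qed.

(** Signs and absolute values of the coefficients, the latter multiplied by the
weight of the constraint and counted in steps of [1 / L]. *)
Definition grid : Type :=
  {ffun 'I_2 * 'I_M -> bool * 'I_(Num.trunc (CB * L%:R)).+1}.

Definition grid_coef (g : grid) : 'I_2 -> 'I_M -> R := fun i m =>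
  (-1) ^+ (g (i, m)).1 * ((g (i, m)).2%:R / (L%:R * w i m)).

(** Rounding is towards 0, so that it does not increase any coefficient and the
rounded coefficients satisfy the constraint again. *)
Lemma grid_approx a : coefficients th CB a -> exists2 g : grid,
  coefficients th CB (grid_coef g) &
  forall i, wnorm1 (th i) (fun m => a i m - grid_coef g i m) <= M%:R / L%:R.
Proof.
move=> aCB; have L0 : 0 < L%:R :> R by rewrite ltr0n.
pose t i m := w i m * `|a i m| * L%:R.
have w_ge0 i m : 0 <= w i m by exact: ltW.
have t0 i m : 0 <= t i m.
  exact: (mulr_ge0 (mulr_ge0 (w_ge0 i m) (normr_ge0 _)) (ltW L0)).
have tle i m : t i m <= CB * L%:R.
  rewrite /t ler_wpM2r//; apply: le_trans (aCB i).
  rewrite (bigD1 m)//= lerDl; apply: sumr_ge0 => m' _.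
  by rewrite mulr_ge0//; exact: w_ge0.
have klt i m : (Num.trunc (t i m) < (Num.trunc (CB * L%:R)).+1)%N.
  by rewrite ltnS; apply: Num.Theory.le_truncn.
pose g : grid := [ffun z => (a z.1 z.2 < 0, Ordinal (klt z.1 z.2))].
have gE i m : grid_coef g i m =
    (-1) ^+ (a i m < 0)%R * ((Num.trunc (t i m))%:R / (L%:R * w i m)).
  by rewrite /grid_coef ffunE.
have kt i m : 0 <= t i m - (Num.trunc (t i m))%:R <= 1.
  have /andP[h1 h2] := Num.Theory.truncn_itv (t0 i m).
  by rewrite subr_ge0 h1 lerBlDl natr1 ltW.
have aE i m : `|a i m| = t i m / (L%:R * w i m).
  by rewrite /t; field; rewrite !gt_eqF.
have Lw i m : 0 < L%:R * w i m by rewrite mulr_gt0.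
exists g => [i|i].
  apply: le_trans (aCB i); apply: ler_sum => m _; rewrite -/(w i m).
  apply: ler_wpM2l => //; rewrite gE normrM normrX normrN normr1 expr1n mul1r.
  rewrite ger0_norm; last by rewrite divr_ge0// ltW.
  rewrite aE ler_pM2r ?invr_gt0//.
  by have /andP[] := kt i m; rewrite subr_ge0.
rewrite /wnorm1; apply: le_trans (_ : \sum_(m < M) L%:R^-1 <= _); last first.
  by rewrite sumr_const card_ord mulr_natl.
apply: ler_sum => m _; rewrite -/(w i m) gE.
rewrite {1}(_ : a i m = (-1) ^+ (a i m < 0)%R * `|a i m|); last first.
  by rewrite -realEsign ?num_real.
rewrite -mulrBr normrM normrX normrN normr1 expr1n mul1r aE -mulrBl normrM.
have /andP[h0 h1] := kt i m.
rewrite (ger0_norm h0) gtr0_norm ?invr_gt0//.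
rewrite (_ : w i m * _ = (t i m - (Num.trunc (t i m))%:R) * L%:R^-1); last first.
  by field; rewrite !gt_eqF.
by rewrite ler_piMl// invr_ge0 ltW.
Qed.

Lemma card_grid : #|{: grid}| = ((2 * (Num.trunc (CB * L%:R)%R).+1) ^ (2 * M))%N.
Proof. by rewrite card_ffun !card_prod card_bool !card_ord. Qed.

Lemma grid_card_gt0 : (0 < #|{: grid}|)%N.
Proof. by rewrite card_grid expn_gt0. Qed.

End covering.

(** * Logarithmic bounds *)

Section logarithms.
Variable R : realType.

Lemma ln1D_ge (y : R) : 0 <= y -> y / (1 + y) <= ln (1 + y).
Proof.
move=> y0; have y1 : 0 < 1 + y by rewrite ltr_wpDr.
rewrite -lerN2 -lnV ?posrE//.
rewrite [X in ln X](_ : _ = 1 + - (y / (1 + y))); last first.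
  by field; rewrite gt_eqF.
apply: le_ln1Dx.
by rewrite ltrN2 ltr_pdivrMr// mul1r ltrDr.
Qed.

Lemma ln2_ge : 2^-1 <= ln 2 :> R.
Proof.
have := @ln1D_ge 1 ler01; rewrite mul1r; exact.
Qed.

(** When there is a single sample and [q] is small, the logarithm in the rate is
of order [q] only; this compares it with the size of the networks. *)
Lemma min1_le_ln1D (q : R) : 0 < q -> Num.min 1 q <= 2 * ln (1 + q).
Proof.
move=> q0; have q1 : 0 < 1 + q by rewrite ltr_wpDr// ltW.
apply: le_trans (_ : 2 * (q / (1 + q)) <= _); last first.
  by rewrite ler_wpM2l// ln1D_ge// ltW.
rewrite mulrA ler_pdivlMr//.
have [h|h] := leP q 1; nra.
Qed.

(** For at least two samples the logarithm in the rate is at least [ln 2], which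
absorbs the numerical constants. *)
Lemma ln_card_grid (M n : nat) (CB q : R) : (0 < M)%N -> (1 < n)%N -> 1 <= CB ->
  0 < q ->
  ln ((2 * (Num.trunc (CB * (n * M)%:R)%R).+1) ^ (2 * M))%N%:R + 1 <=
  8 * M%:R * ln (CB * M%:R * (q + 1) * n%:R).
Proof.
move=> M0 n1 CB1 q0.
have M1 : 1 <= M%:R :> R by rewrite ler1n.
have n2 : 2 <= n%:R :> R by rewrite ler_nat.
set Y := CB * M%:R * (q + 1) * n%:R.
set K := (Num.trunc _).+1.
have X1 : 2 <= CB * (n * M)%:R.
  rewrite -[2]mul1r; apply: ler_pM => //; rewrite natrM -[2]mulr1.
  exact: ler_pM.
have XY : CB * (n * M)%:R <= Y.
  rewrite (_ : Y = CB * (n * M)%:R + CB * (n * M)%:R * q); last first.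
    by rewrite /Y natrM; ring.
  by rewrite lerDl mulr_ge0// ltW// (lt_le_trans _ X1).
have Y2 : 2 <= Y by apply: le_trans XY.
have Y0 : 0 < Y by apply: lt_le_trans Y2.
have lnY : ln 2 <= ln Y by rewrite ler_ln ?posrE.
have l2 := ln2_ge.
have KX : (2 * K)%:R <= 2 * 2 * Y.
  rewrite natrM -mulrA ler_wpM2l//.
  have : (Num.trunc (CB * (n * M)%:R))%:R <= CB * (n * M)%:R.
    by rewrite Num.Theory.truncn_le; apply: le_trans X1.
  rewrite /K -natr1; lra.
have K0 : 0 < (2 * K)%:R :> R by rewrite ltr0n.
have Y4 : 0 < 2 * 2 * Y by nra.
have lnK2 : ln (2 * K)%:R <= 3 * ln Y.
  apply: le_trans (_ : ln (2 * 2 * Y) <= _); first by rewrite ler_ln ?posrE.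
  have -> : ln (2 * 2 * Y) = ln 2 + ln 2 + ln Y.
    have p4 : 0 < 2 * 2 :> R by nra.
    by rewrite (@lnM R (2 * 2) Y) ?posrE// (@lnM R 2 2) ?posrE.
  lra.
rewrite natrX lnXn// -[_ *+ _]mulr_natl [(2 * M)%:R]natrM.
have := ler_wpM2l (ler0n R M) lnK2; nra.
Qed.

End logarithms.

(** * Deviation of the loss on one site *)

Section site_deviation.
Variables (R : realType) (d : nat) (pb : interface_problem R d).
Local Notation E := 'rV[R]_d.
Local Notation param := 'rV[R]_(d + 1).
Hypothesis geometry : interface_geometry pb.
Variables (U : 'I_5 -> probability E R).
Hypothesis uniform :
  forall k, uniform_on (@site_measure R d k) (site pb k) (U k).
Hypothesis regularity : data_regularity pb U.
Variable v : E -> R.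
Hypothesis solution : exact_solution pb v.
Variables (r K0 : R) (r_ge0 : 0 <= r) (K0_ge0 : 0 <= K0).
Hypothesis Omega_r : forall x, closure (Omega pb) x -> forall j, `|x 0 j| <= r.
Hypothesis trace_K0 : forall i s x, constant s -> (size s <= 2)%N ->
  closure (subdomain pb i) x -> `|trace (subdomain pb i) (pds s v) x| <= K0.

(** With the coefficients bounded by [CB], residuals are at most [loss_cst * CB]. *)
Definition loss_cst : R := residual_cst pb * (K0 + (2 + d%:R * r)).

Variables (q : R) (q_gt0 : 0 < q) (M n : nat) (M_gt0 : (0 < M)%N) (n_gt0 : (0 < n)%N).
Variable th : 'I_2 -> 'I_M -> param.
Hypothesis th_cube : forall i m, cube q (th i m).
Variables (CB : R) (CB_ge1 : 1 <= CB).
Implicit Types a b : 'I_2 -> 'I_M -> R.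

Local Notation A := loss_cst.
Local Notation res := (residual pb v th).
Local Notation loss a := (loss_term pb (rann_pair th a)).

Lemma residual_cst_ge2 : 2 <= residual_cst pb.
Proof.
have [_ _ _ _ b0] := geometry; by rewrite lerDr mulr_ge0// addr_ge0// ltW.
Qed.

Lemma loss_cst_gt0 : 0 < A.
Proof.
apply: mulr_gt0; first by apply: lt_le_trans residual_cst_ge2.
by rewrite ltr_wpDl// ltr_pwDl// mulr_ge0.
Qed.

Lemma residual_lipschitz_loss_cst a b k x (W : R) : 0 <= W -> site pb k x ->
  (forall i, wnorm1 (th i) (fun m => a i m - b i m) <= W) ->
  `|res a k x - res b k x| <= A * (Num.min 1 q * W).
Proof.
move=> W0 sx abW.
apply: le_trans (residual_lipschitz geometry v r_ge0 Omega_r q_gt0 th_cube W0 sx abW) _.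
have kap0 : 0 <= Num.min 1 q by rewrite le_min ler01 ltW.
rewrite /loss_cst -!mulrA; apply: ler_wpM2l.
  by apply: le_trans residual_cst_ge2.
by apply: ler_wpM2r; [exact: mulr_ge0|rewrite lerDr].
Qed.

Lemma residual_le_loss_cst a k x : site pb k x -> coefficients th CB a ->
  `|res a k x| <= A * CB.
Proof.
move=> sx aCB.
apply: le_trans (residual_bound geometry r_ge0 Omega_r q_gt0 th_cube K0_ge0 sx
  trace_K0 aCB) _.
rewrite /loss_cst -mulrA; apply: ler_wpM2l; first by apply: le_trans residual_cst_ge2.
by rewrite [leRHS]mulrDl lerD2r ler_peMr.
Qed.

Lemma loss_lipschitz a b k x (W : R) : 0 <= W -> site pb k x ->
  coefficients th CB a -> coefficients th CB b ->
  (forall i, wnorm1 (th i) (fun m => a i m - b i m) <= W) ->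
  `|loss a k x - loss b k x| <= 2 * A ^+ 2 * CB * W.
Proof.
move=> W0 sx aCB bCB abW; rewrite !(loss_termE geometry solution)//.
rewrite subr_sqr normrM.
have A0 := ltW loss_cst_gt0.
have h1 : `|res a k x - res b k x| <= A * W.
  apply: le_trans (residual_lipschitz_loss_cst W0 sx abW) _; apply: ler_wpM2l => //.
  by rewrite ler_piMl// ge_min lexx.
have h2 : `|res a k x + res b k x| <= A * CB + A * CB.
  by apply: le_trans (ler_normD _ _) _; apply: lerD; exact: residual_le_loss_cst.
apply: le_trans (ler_pM _ _ h1 h2) _ => //.
by rewrite le_eqVlt; apply/orP; left; apply/eqP; ring.
Qed.

Variables (d2 : measure_display) (T2 : measurableType d2) (P2 : probability T2 R).
Variables (k : 'I_5) (N : nat) (X : 'I_N -> T2 -> E).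
Hypotheses (N_gt0 : (0 < N)%N) (iidX : iid P2 X (U k)).

(** Every admissible network is within [1 / n] of a network of the grid with step
[1 / (n * M)], to which the deviation bound for finite classes applies.  The
loss changes three times on the way: once under the expectation, twice under
the doubled empirical mean. *)
Lemma site_deviation : exists D : T2 -> R,
  [/\ measurable_fun setT D, forall t, 0 <= D t,
      (\int[P2]_t (D t)%:E <= (2 * (A * CB) ^+ 2 / N%:R *
        (ln ((2 * (Num.trunc (CB * (n * M)%:R)%R).+1) ^ (2 * M))%N%:R + 1))%:E)%E &
      forall a t, coefficients th CB a -> (forall j, site pb k (X j t)) ->
        (\int[U k]_(x in site pb k) (loss a k x)%:E <=
         (2 * (N%:R^-1 * \sum_j loss a k (X j t)) + D t +
          6 * A ^+ 2 * CB / n%:R)%:E)%E].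
Proof.
have CB0 : 0 <= CB by apply: le_trans CB_ge1.
have A0 := loss_cst_gt0.
have L0 : (0 < n * M)%N by rewrite muln_gt0 n_gt0.
set S := site pb k.
have mS : measurable S := measurable_site geometry k.
pose ok g := `[< coefficients th CB (@grid_coef R d M th CB (n * M) g) >].
pose l g := loss (@grid_coef R d M th CB (n * M) g) k.
(* Off the site and for grid points that violate the constraint the loss has
   no bound, so it is replaced by 0 there. *)
pose W g x := if ok g then (l g \_ S) x else 0.
have ml g : measurable_fun S (l g).
  exact: (measurable_loss geometry regularity).
have mW g : measurable_fun setT (W g).
  rewrite /W; case: (ok g); last exact: measurable_cst.
  exact/(measurable_restrictT _ _).1.
have loss0 a x : S x -> 0 <= loss a k x.
  by move=> Sx; rewrite (loss_termE geometry solution)// sqr_ge0.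
have W_itv g x : 0 <= W g x <= (A * CB) ^+ 2.
  rewrite /W; case: (boolP (ok g)) => [/asboolP okg|_]; last by rewrite lexx sqr_ge0.
  rewrite /patch; case: ifPn => [/set_mem Sx|_]; last by rewrite lexx sqr_ge0.
  rewrite loss0//= /l (loss_termE geometry solution)//.
  rewrite -real_normK ?num_real// lerXn2r ?nnegrE//.
    by rewrite mulr_ge0// ltW.
  exact: residual_le_loss_cst.
have B0 : 0 < (A * CB) ^+ 2.
  by rewrite exprn_gt0// mulr_gt0// (lt_le_trans _ CB_ge1).
have [D [mD D0 intD devD]] := uniform_deviation N_gt0 iidX B0
  (grid_card_gt0 M CB (n * M)) mW W_itv.
exists D; split => //; first by rewrite -card_grid.
move=> a t aCB tS.
have [g gCB ga] := grid_approx L0 aCB.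
have gW x : S x -> W g x = loss (grid_coef th g) k x.
  by move=> Sx; rewrite /W /ok asboolT// /patch mem_set.
pose e := 2 * A ^+ 2 * CB / n%:R.
have nn : n%:R != 0 :> R by rewrite pnatr_eq0 -lt0n.
have Mn : M%:R != 0 :> R by rewrite pnatr_eq0 -lt0n.
have e0 : 0 <= e by rewrite /e divr_ge0// mulr_ge0// mulr_ge0// sqr_ge0.
have close x : S x -> `|loss a k x - l g x| <= e.
  move=> Sx; rewrite /e.
  have -> : n%:R^-1 = M%:R / (n * M)%:R :> R by rewrite natrM; field; rewrite nn Mn.
  by apply: loss_lipschitz; rewrite ?divr_ge0.
apply: le_trans (integral_le_restrict mS (uniform_site1 geometry uniform k) e0
  _ (ml g) _ _ _) _.
- exact: (measurable_loss geometry regularity).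
- by move=> x; exact: loss0.
- by move=> x; exact: loss0.
- by move=> x Sx; have := close x Sx; rewrite ler_distl => /andP[_].
have -> : (\int[U k]_x ((l g \_ S) x)%:E = \int[U k]_x (W g x)%:E)%E.
  by apply: eq_integral => x _; rewrite /W /ok asboolT.
apply: le_trans (leeD2r _ (devD g t)) _.
rewrite -EFinD lee_fin.
have emp : empirical_mean X (W g) t <= N%:R^-1 * (\sum_j loss a k (X j t)) + e.
  have -> : e = N%:R^-1 * \sum_(j < N) e.
    by rewrite sumr_const card_ord -[e *+ N]mulr_natl mulKf// pnatr_eq0 -lt0n.
  rewrite -mulrDr /empirical_mean -big_split/=; apply: ler_wpM2l => //.
  apply: ler_sum => j _; rewrite gW//.
  by have := close _ (tS j); rewrite ler_distl => /andP[+ _]; rewrite lerBlDr.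
have -> : 6 * A ^+ 2 * CB / n%:R = 3 * e by rewrite /e; ring.
lra.
Qed.

End site_deviation.

(** * Risk bound for fixed hidden parameters *)

Section risk_bound.
Variables (R : realType) (d : nat) (pb : interface_problem R d).
Local Notation E := 'rV[R]_d.
Local Notation param := 'rV[R]_(d + 1).
Hypothesis geometry : interface_geometry pb.
Variables (U : 'I_5 -> probability E R).
Hypothesis uniform :
  forall k, uniform_on (@site_measure R d k) (site pb k) (U k).
Hypothesis regularity : data_regularity pb U.
Variable v : E -> R.
Hypothesis solution : exact_solution pb v.
Variables (r K0 : R) (r_ge0 : 0 <= r) (K0_ge0 : 0 <= K0).
Hypothesis Omega_r : forall x, closure (Omega pb) x -> forall j, `|x 0 j| <= r.
Hypothesis trace_K0 : forall i s x, constant s -> (size s <= 2)%N ->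
  closure (subdomain pb i) x -> `|trace (subdomain pb i) (pds s v) x| <= K0.
Variables (lam : 'I_5 -> R) (c1 c2 : R) (c1_gt0 : 0 < c1).

Local Notation A := (loss_cst pb r K0).
Local Notation rc := (residual_cst pb).
Local Notation Lam := (\sum_k lam k ^+ 2).

(** It depends on the problem, on the penalty weights and on the bounds for the
ratios of the sample sizes.  The first summand in the parentheses pays for the
approximation error, the second for the deviation: [16 / c1] for the deviation
over the grid, and 48, rounded up, for the passage to the grid. *)
Definition risk_cst : R :=
  1 + Lam * (2 * rc ^+ 2 * (1 + `|c2| / c1) + A ^+ 2 * (50 + 16 / c1)).

Lemma C2_norm_ge0 i f : (0 <= C2_norm (subdomain pb i) f)%E.
Proof.
have [x Dx] := subdomain_nonempty uniform i.
have s0 g : (0 <= sup_abs (subdomain pb i) g)%E.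
  apply: (@le_trans _ _ `|g x|%:E); first by rewrite lee_fin.
  by apply: ereal_sup_ubound; exists x.
rewrite /C2_norm !adde_ge0//; first by apply: sume_ge0 => j _; exact: s0.
by apply: sume_ge0 => j _; apply: sume_ge0 => j' _; exact: s0.
Qed.

Lemma X_norm2_ge0 u : (0 <= X_norm2 pb u)%E.
Proof. by apply: sume_ge0 => i _; rewrite expe2 mule_ge0// C2_norm_ge0. Qed.

Lemma risk_cst_gt0 : 0 < risk_cst.
Proof.
rewrite /risk_cst ltr_pwDl//; apply: mulr_ge0.
  by apply: sumr_ge0 => k _; exact: sqr_ge0.
apply: addr_ge0; apply: mulr_ge0.
- by rewrite mulr_ge0// sqr_ge0.
- by rewrite addr_ge0// divr_ge0// ltW.
- exact: sqr_ge0.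
- by rewrite addr_ge0// divr_ge0// ltW.
Qed.

Lemma C2_norms_le u (x : R) : X_norm2 pb u = x%:E ->
  exists2 K : R, 0 <= K & K ^+ 2 <= x /\
    forall i, (C2_norm (subdomain pb i) (u i) <= K%:E)%E.
Proof.
rewrite /X_norm2 big_ord_recl big_ord1.
set i1 := lift _ _ => uE.
have c0 := C2_norm_ge0 0 (u 0); have c1' := C2_norm_ge0 i1 (u i1).
move: uE c0 c1'.
case e0 : (C2_norm _ (u 0)) => [y0| |//]; case e1 : (C2_norm _ (u i1)) => [y1| |//].
- rewrite !expe2 -!EFinM -EFinD !lee_fin => -[<-] y00 y10.
  exists (Num.max y0 y1); first by rewrite le_max y00.
  split; first by case: (leP y0 y1) => _; rewrite expr2 ?lerDr ?lerDl mulr_ge0.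
  move=> i; have [->|->] : i = 0 \/ i = i1.
  + by case: i => -[|[|//]] ?; [left|right]; exact: val_inj.
  + by rewrite e0 lee_fin le_max lexx.
  + by rewrite e1 lee_fin le_max lexx orbT.
- by rewrite !expe2 mulyy -EFinM addey.
- by rewrite !expe2 mulyy -EFinM addye.
- by rewrite !expe2 mulyy addye.
Qed.

Variables (q : R) (q_gt0 : 0 < q) (M n : nat) (M_gt0 : (0 < M)%N) (n_gt0 : (0 < n)%N).
Variable th : 'I_2 -> 'I_M -> param.
Hypothesis th_cube : forall i m, cube q (th i m).
Variables (CB : R) (CB_ge1 : 1 <= CB).
Variables (d2 : measure_display) (T2 : measurableType d2) (P2 : probability T2 R).
Variables (N : 'I_5 -> nat) (X : forall k, 'I_(N k) -> T2 -> E).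
Arguments X : clear implicits.
Hypothesis N_n : forall k, c1 * n%:R <= (N k)%:R <= c2 * n%:R.
Hypothesis iidX : forall k, iid P2 (X k) (U k).

Local Notation loss a := (loss_term pb (rann_pair th a)).
Local Notation emp t u :=
  (empirical_loss pb lam (fun k j => X k j t) (rann_pair th u)).
Local Notation rate := (CB ^+ 4 * M%:R * ln (CB * M%:R * (q + 1) * n%:R) / n%:R).

Lemma loss_ge0 a k x : site pb k x -> 0 <= loss a k x.
Proof. by move=> sx; rewrite (loss_termE geometry solution)// sqr_ge0. Qed.

Lemma expected_loss_ge0 a : (0 <= expected_loss pb lam U (rann_pair th a))%E.
Proof.
apply: sume_ge0 => k _; rewrite mule_ge0 ?lee_fin ?sqr_ge0//.
by apply: integral_ge0 => x sx; rewrite lee_fin loss_ge0.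
Qed.

Lemma expected_loss_le a (b : 'I_5 -> R) :
  (forall k, \int[U k]_(x in site pb k) (loss a k x)%:E <= (b k)%:E)%E ->
  (expected_loss pb lam U (rann_pair th a) <= (\sum_k lam k ^+ 2 * b k)%:E)%E.
Proof.
move=> ab; rewrite -sumEFin; apply: lee_sum => k _.
by rewrite [leRHS]EFinM; apply: lee_wpmul2l; rewrite ?lee_fin ?sqr_ge0.
Qed.

Lemma samples_in_sites : {ae P2, forall t, forall k j, site pb k (X k j t)}.
Proof.
apply: filter_forall => k; apply: filter_forall => j.
have [mX lawX _] := iidX k.
exists (~` (X k j @^-1` site pb k)); split => //.
- apply: measurableC; rewrite -[X in measurable X]setTI.
  by apply: mX => //; exact: measurable_site.
- change (~` (X k j @^-1` site pb k)) with (X k j @^-1` (~` site pb k)).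
  rewrite lawX; last by apply: measurableC; exact: measurable_site.
  rewrite probability_setC; last exact: measurable_site.
  by rewrite (uniform_site1 geometry uniform) subee.
Qed.

Lemma rate_ge0 : 0 <= rate.
Proof.
have M1 : 1 <= M%:R :> R by rewrite ler1n.
have n1 : 1 <= n%:R :> R by rewrite ler1n.
have CB0 : 0 <= CB by apply: le_trans CB_ge1.
rewrite divr_ge0// mulr_ge0//; first by rewrite mulr_ge0// exprn_ge0.
apply: ln_ge0; rewrite -[leLHS]mulr1; apply: ler_pM => //.
rewrite -[leLHS]mulr1; apply: ler_pM => //; last by rewrite lerDr ltW.
by rewrite -[leLHS]mulr1; apply: ler_pM.
Qed.

Lemma residual_cst_ge0 : 0 <= rc.
Proof. by apply: le_trans (residual_cst_ge2 geometry). Qed.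

Lemma wnorm1B_le a b i : coefficients th CB a -> coefficients th CB b ->
  wnorm1 (th i) (fun m => a i m - b i m) <= 2 * CB.
Proof.
move=> aCB bCB; rewrite mulr_natl mulr2n.
apply: le_trans (lerD (aCB i) (bCB i)); rewrite /wnorm1 -big_split/=.
apply: ler_sum => m _; rewrite -mulrDr; apply: ler_wpM2l; first exact: sqr_ge0.
exact: ler_normB.
Qed.

Let Lam_ge0 : 0 <= Lam.
Proof. by apply: sumr_ge0 => k _; exact: sqr_ge0. Qed.

Let A_gt0 : 0 < A.
Proof. exact: loss_cst_gt0. Qed.

Lemma risk_cst_ge (x y : R) : 0 <= x -> 0 <= y ->
  Lam * (2 * rc ^+ 2 * (1 + `|c2| / c1) * x + A ^+ 2 * (50 + 16 / c1) * y) <=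
  risk_cst * (x + y).
Proof.
move=> x0 y0; rewrite /risk_cst; set a := 2 * _ * _; set b := A ^+ 2 * _.
have p0 : 0 <= `|c2| / c1 by rewrite divr_ge0// ltW.
have a0 : 0 <= a by rewrite /a !mulr_ge0 ?exprn_ge0 ?residual_cst_ge0// addr_ge0.
have b0 : 0 <= b.
  by rewrite /b mulr_ge0 ?sqr_ge0// addr_ge0// divr_ge0// ltW.
have := mulr_ge0 Lam_ge0 (mulr_ge0 a0 y0).
have := mulr_ge0 Lam_ge0 (mulr_ge0 b0 x0).
rewrite -/Lam; nra.
Qed.

Lemma CB_sqr_le : CB ^+ 2 <= CB ^+ 4 * M%:R.
Proof.
have M1 : 1 <= M%:R :> R by rewrite ler1n.
have CB2 : 1 <= CB ^+ 2 by rewrite exprn_ege1.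
rewrite (_ : CB ^+ 4 = CB ^+ 2 * CB ^+ 2); last by ring.
rewrite -[leLHS]mulr1; apply: ler_pM => //; first exact: sqr_ge0.
by rewrite ler_peMr// sqr_ge0.
Qed.

(** With one sample the rate may be arbitrarily small, as [q] tends to 0, and no
concentration is available.  But then any two admissible networks are close to
each other, at distance of order [CB * Num.min 1 q], so the loss of every one of
them is comparable to that of [a]. *)
Lemma expected_loss_single a b (K x : R) : n = 1%N ->
  coefficients th CB a -> coefficients th CB b -> 0 <= K -> K ^+ 2 <= x ->
  (forall i, (C2_norm (subdomain pb i)
                (fun y => (rann_pair th a i y - v y)%R) <= K%:E)%E) ->
  (expected_loss pb lam U (rann_pair th b) <= (risk_cst * (x + rate))%:E)%E.
Proof.
move=> n1 aCB bCB K_ge0 Kx aK.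
have CB0 : 0 <= CB by apply: le_trans CB_ge1.
pose kap := Num.min 1 q.
have kap0 : 0 <= kap by rewrite le_min ler01 ltW.
have kap1 : kap <= 1 by rewrite ge_min lexx.
pose B := 2 * (rc * K) ^+ 2 + 2 * (A * (kap * (2 * CB))) ^+ 2.
have lossB k x' : site pb k x' -> 0 <= loss b k x' <= B.
  move=> sx; rewrite loss_ge0//= (loss_termE geometry solution)//.
  have h1 := residual_le_C2_norm geometry uniform solution K_ge0 sx aK.
  have h2 := residual_lipschitz_loss_cst geometry v r_ge0 K0_ge0 Omega_r q_gt0 th_cube
    (mulr_ge0 (ler0n _ 2) CB0) sx (fun i => wnorm1B_le i bCB aCB).
  set ra := residual _ _ _ a _ _ in h1 h2.
  set rb := residual _ _ _ b _ _ in h2 *.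
  have h1' : ra ^+ 2 <= (rc * K) ^+ 2.
    by rewrite -real_normK ?num_real// lerXn2r ?nnegrE// mulr_ge0// residual_cst_ge0.
  have h2' : (rb - ra) ^+ 2 <= (A * (kap * (2 * CB))) ^+ 2.
    rewrite -real_normK ?num_real// lerXn2r ?nnegrE//.
    by apply: le_trans h2.
  rewrite /B; have := sqr_ge0 (rb - ra - ra); nra.
apply: (@le_trans _ _ (\sum_k lam k ^+ 2 * B)%:E).
  apply: expected_loss_le => k; apply: integral_le_cst.
  - exact: measurable_site.
  - exact: uniform_site1.
  - exact: (measurable_loss geometry regularity).
  - exact: lossB.
rewrite lee_fin -mulr_suml.
have x0 : 0 <= x by apply: le_trans Kx; exact: sqr_ge0.
have y0 := rate_ge0.
apply: le_trans (risk_cst_ge x0 y0); apply: ler_wpM2l => //.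
have p0 : 0 <= `|c2| / c1 by rewrite divr_ge0// ltW.
have p1 : 0 <= 16 / c1 by rewrite divr_ge0// ltW.
have rc0 := residual_cst_ge0; have A0 := ltW A_gt0.
have kaprate : kap ^+ 2 * CB ^+ 2 <= 2 * rate.
  rewrite n1 divr1 mulr1.
  have Lq : ln (1 + q) <= ln (CB * M%:R * (q + 1)).
    rewrite ler_ln ?posrE.
    - rewrite addrC ler_peMl//; first by rewrite addr_ge0// ltW.
      by rewrite -[leLHS]mulr1; apply: ler_pM => //; rewrite ler1n.
    - by rewrite addr_gt0.
    - rewrite !mulr_gt0 ?addr_gt0 ?ltr0n//.
      exact: lt_le_trans CB_ge1.
  have Lk := min1_le_ln1D q_gt0; rewrite -/kap in Lk.
  apply: le_trans (_ : kap * (CB ^+ 4 * M%:R) <= _).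
    apply: ler_pM; [exact: sqr_ge0|exact: sqr_ge0| |exact: CB_sqr_le].
    by rewrite expr2 ler_piMl.
  rewrite mulrC mulrCA; apply: ler_wpM2l.
    by rewrite mulr_ge0// exprn_ge0.
  by apply: le_trans Lk _; rewrite ler_wpM2l.
have q1 : 0 <= 2 * rc ^+ 2 * (`|c2| / c1) * x.
  by rewrite mulr_ge0// mulr_ge0// mulr_ge0// sqr_ge0.
have q2 : 0 <= A ^+ 2 * (16 / c1) * rate by rewrite mulr_ge0// mulr_ge0// sqr_ge0.
have q3 : 0 <= A ^+ 2 * rate by rewrite mulr_ge0// sqr_ge0.
have q4 : rc ^+ 2 * K ^+ 2 <= rc ^+ 2 * x by rewrite ler_wpM2l// sqr_ge0.
have q5 : A ^+ 2 * (kap ^+ 2 * CB ^+ 2) <= A ^+ 2 * (2 * rate).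
  by rewrite ler_wpM2l// sqr_ge0.
rewrite /B (exprMn _ rc) (exprMn _ A) (exprMn _ kap) (exprMn _ 2).
move: q1 q2 q3 q4 q5; set RR := rate; set C2 := `|c2| / c1; set C16 := 16 / c1.
by move=> q1 q2 q3 q4 q5; lra.
Qed.

(** On each site the loss is at most twice its empirical mean plus a deviation.
Since the sample sizes are comparable, the empirical means are controlled by the
empirical loss of the minimiser, hence by that of [a], hence by the C2 distance
between [a] and the exact solution.  The deviations of the five sites are added
up. *)
Lemma risk_bound_many a ahat (K x : R) : (1 < n)%N ->
  coefficients th CB a -> (forall t, coefficients th CB (ahat t)) ->
  (forall t, emp t (ahat t) <= emp t a) -> 0 <= K -> K ^+ 2 <= x ->
  (forall i, (C2_norm (subdomain pb i)
                (fun y => (rann_pair th a i y - v y)%R) <= K%:E)%E) ->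
  (\int[P2]_t expected_loss pb lam U (rann_pair th (ahat t)) <=
   (risk_cst * (x + rate))%:E)%E.
Proof.
move=> n1 aCB ahatCB ahat_min K_ge0 Kx aK.
have CB0 : 0 <= CB by apply: le_trans CB_ge1.
have nR : 0 < n%:R :> R by rewrite ltr0n.
have cn0 : 0 < c1 * n%:R by rewrite mulr_gt0.
have NR k : 0 < (N k)%:R :> R.
  by have /andP[h _] := N_n k; apply: lt_le_trans h.
have N_gt0 k : (0 < N k)%N by have := NR k; rewrite ltr0n.
pose lnG : R := ln ((2 * (Num.trunc (CB * (n * M)%:R)%R).+1) ^ (2 * M))%N%:R + 1.
pose e := 6 * A ^+ 2 * CB / n%:R.
have devk k : exists D : T2 -> R,
  [/\ measurable_fun setT D, forall t, 0 <= D t,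
      (\int[P2]_t (D t)%:E <= (2 * (A * CB) ^+ 2 / (N k)%:R * lnG)%:E)%E &
      forall b t, coefficients th CB b -> (forall j, site pb k (X k j t)) ->
        (\int[U k]_(x in site pb k) (loss b k x)%:E <=
         (2 * ((N k)%:R^-1 * \sum_j loss b k (X k j t)) + D t + e)%:E)%E].
  exact: (site_deviation geometry uniform regularity solution r_ge0 K0_ge0
    Omega_r trace_K0 q_gt0 M_gt0 n_gt0 th_cube CB_ge1 (N_gt0 k) (iidX k)).
have /choice[D DP] := devk.
have mD k : measurable_fun setT (D k) by have [] := DP k.
have D_ge0 k t : 0 <= D k t by have [_ h _ _] := DP k.
have intD k : (\int[P2]_t (D k t)%:E <= (2 * (A * CB) ^+ 2 / (c1 * n%:R) * lnG)%:E)%E.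
  have [_ _ h _] := DP k; apply: le_trans h _; rewrite lee_fin.
  have lnG0 : 0 <= lnG by rewrite addr_ge0// ln_ge0// ler1n expn_gt0.
  apply: ler_wpM2r => //; apply: ler_wpM2l; first by rewrite mulr_ge0// sqr_ge0.
  by rewrite lef_pV2 ?posrE//; have /andP[] := N_n k.
pose S0 := 2 * (`|c2| / c1) * Lam * (rc * K) ^+ 2.
have emp_a t : (forall k j, site pb k (X k j t)) ->
    2 / (c1 * n%:R) * emp t a <= S0.
  move=> tS; rewrite /empirical_loss.
  apply: le_trans (_ : 2 / (c1 * n%:R) *
      (\sum_k lam k ^+ 2 * (`|c2| * n%:R * (rc * K) ^+ 2)) <= _); last first.
    by rewrite -mulr_suml /S0 le_eqVlt; apply/orP; left; apply/eqP; field; rewrite !gt_eqF.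
  apply: ler_wpM2l; first by rewrite divr_ge0// ltW.
  apply: ler_sum => k _; apply: ler_wpM2l; first exact: sqr_ge0.
  apply: le_trans (_ : \sum_(j < N k) (rc * K) ^+ 2 <= _).
    apply: ler_sum => j _; rewrite (loss_termE geometry solution)//.
    rewrite -real_normK ?num_real// lerXn2r ?nnegrE ?mulr_ge0 ?residual_cst_ge0//.
    exact: (residual_le_C2_norm geometry uniform solution K_ge0 (tS k j) aK).
  rewrite sumr_const card_ord -[_ *+ N k]mulr_natl; apply: ler_wpM2r; first exact: sqr_ge0.
  have /andP[_ h] := N_n k; apply: le_trans h _; apply: ler_wpM2r; first exact: ltW.
  exact: ler_norm.
pose g t := S0 + Lam * e + \sum_k lam k ^+ 2 * D k t.
have ub t : (forall k j, site pb k (X k j t)) ->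
    (expected_loss pb lam U (rann_pair th (ahat t)) <= (g t)%:E)%E.
  move=> tS.
  pose b k := 2 * ((N k)%:R^-1 * \sum_j loss (ahat t) k (X k j t)) + D k t + e.
  apply: (@le_trans _ _ (\sum_k lam k ^+ 2 * b k)%:E).
    by apply: expected_loss_le => k; have [_ _ _] := DP k; apply.
  rewrite lee_fin /g.
  have -> : \sum_k lam k ^+ 2 * b k =
    \sum_k lam k ^+ 2 * (2 * ((N k)%:R^-1 * \sum_j loss (ahat t) k (X k j t))) +
    Lam * e + \sum_k lam k ^+ 2 * D k t.
    by rewrite mulr_suml -!big_split/=; apply: eq_bigr => k _; rewrite /b; ring.
  rewrite !lerD2r; apply: le_trans (emp_a t tS).
  apply: le_trans (_ : 2 / (c1 * n%:R) * emp t (ahat t) <= _); last first.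
    by rewrite ler_wpM2l// divr_ge0// ltW.
  rewrite /empirical_loss mulr_sumr; apply: ler_sum => k _.
  rewrite [leRHS]mulrCA; apply: ler_wpM2l; first exact: sqr_ge0.
  rewrite [leLHS]mulrA; apply: ler_wpM2r.
    by apply: sumr_ge0 => j _; exact: loss_ge0.
  apply: ler_wpM2l => //; rewrite lef_pV2 ?posrE//.
  by have /andP[] := N_n k.
have e0 : 0 <= e.
  by rewrite /e divr_ge0// mulr_ge0// mulr_ge0// sqr_ge0.
have S00 : 0 <= S0.
  rewrite /S0 mulr_ge0 ?sqr_ge0// mulr_ge0// mulr_ge0// divr_ge0//.
  exact: ltW.
have sD0 t : 0 <= \sum_k lam k ^+ 2 * D k t.
  by apply: sumr_ge0 => k _; rewrite mulr_ge0// sqr_ge0.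
have c0 : 0 <= S0 + Lam * e by rewrite addr_ge0// mulr_ge0.
have g0 t : 0 <= g t by rewrite addr_ge0.
have msD : measurable_fun setT (fun t => \sum_k lam k ^+ 2 * D k t).
  by apply: measurable_sum => k; exact: measurable_funM.
have mg : measurable_fun setT g by exact: measurable_funD.
apply: (@le_trans _ _ (\int[P2]_t (g t)%:E)%E).
  apply: le_integral_measurable_ub.
  - by move=> t; exact: expected_loss_ge0.
  - by move=> t; rewrite lee_fin.
  - exact/measurable_EFinP.
  - by apply: filterS samples_in_sites => t tS; exact: ub.
under eq_integral do rewrite /g EFinD.
rewrite ge0_integralD//; last 2 first.
- by move=> t _; rewrite lee_fin.
- exact/measurable_EFinP.
rewrite integral_cst// [X in (_ * X)%E](@probability_setT _ _ _ P2) mule1.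
under eq_integral do rewrite -sumEFin.
rewrite ge0_integral_sum//; last 2 first.
- by move=> k; apply/measurable_EFinP; exact: measurable_funM.
- by move=> k t _; rewrite lee_fin mulr_ge0// sqr_ge0.
pose dev := 2 * (A * CB) ^+ 2 / (c1 * n%:R) * lnG.
apply: (@le_trans _ _ ((S0 + Lam * e)%:E + \sum_(k < 5) (lam k ^+ 2 * dev)%:E)%E).
  apply: leeD => //; apply: lee_sum => k _.
  under eq_integral do rewrite EFinM.
  rewrite ge0_integralZl_EFin//; last 3 first.
  - by move=> t _; rewrite lee_fin.
  - exact/measurable_EFinP.
  - exact: sqr_ge0.
  rewrite [leRHS]EFinM; apply: lee_wpmul2l; first by rewrite lee_fin sqr_ge0.
  exact: intD.
rewrite sumEFin -EFinD lee_fin -mulr_suml.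
have x0 : 0 <= x by apply: le_trans Kx; exact: sqr_ge0.
apply: le_trans (risk_cst_ge x0 rate_ge0).
have lnG1 : 1 <= lnG by rewrite lerDr ln_ge0// ler1n expn_gt0.
have lnG_le := ln_card_grid M_gt0 n1 CB_ge1 q_gt0.
rewrite -/lnG in lnG_le.
set Lg := ln (CB * M%:R * (q + 1) * n%:R) in lnG_le *.
pose Z := M%:R * Lg / n%:R.
have rateE : CB ^+ 4 * M%:R * Lg / n%:R = CB ^+ 4 * Z by rewrite /Z; ring.
(* The logarithm of the size of the grid, increased by 1, is at least 1. *)
have Zn : n%:R^-1 <= 8 * Z.
  rewrite /Z mulrA mulrA -[leLHS]mul1r; apply: ler_wpM2r; first by rewrite invr_ge0.
  exact: le_trans lnG_le.
have Z0 : 0 <= Z.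
  by rewrite -(pmulr_rge0 _ (ltr0Sn R 7)); apply: le_trans Zn; rewrite invr_ge0.
have CB4 : CB <= CB ^+ 4 by rewrite ler_eXnr.
have CB24 : CB ^+ 2 <= CB ^+ 4 by rewrite ler_weXn2l.
have A2 : 0 <= A ^+ 2 by exact: sqr_ge0.
have eZ : e <= 48 * (A ^+ 2 * (CB ^+ 4 * Z)).
  rewrite (_ : e = 6 * (A ^+ 2 * (CB * n%:R^-1))); last by rewrite /e; ring.
  rewrite (_ : 48 * _ = 6 * (A ^+ 2 * (CB ^+ 4 * (8 * Z)))); last by ring.
  apply: ler_wpM2l => //; apply: ler_wpM2l => //.
  by apply: ler_pM; rewrite ?invr_ge0.
have devZ : dev <= A ^+ 2 * (16 / c1) * (CB ^+ 4 * Z).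
  apply: le_trans (_ : A ^+ 2 * (16 / c1) * (CB ^+ 2 * Z) <= _); last first.
    apply: ler_wpM2l; first by rewrite mulr_ge0// divr_ge0// ltW.
    exact: ler_wpM2r.
  rewrite /dev (_ : A ^+ 2 * (16 / c1) * (CB ^+ 2 * Z) =
    2 * (A * CB) ^+ 2 / (c1 * n%:R) * (8 * M%:R * Lg)); last first.
    by rewrite /Z; field; rewrite !gt_eqF.
  apply: ler_wpM2l => //; rewrite divr_ge0 ?(ltW cn0)//.
  by rewrite mulr_ge0// sqr_ge0.
rewrite rateE.
have S0x : S0 <= Lam * (2 * rc ^+ 2 * (`|c2| / c1) * x).
  rewrite (_ : S0 = Lam * (2 * (`|c2| / c1) * rc ^+ 2 * K ^+ 2)); last first.
    by rewrite /S0; ring.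
  apply: ler_wpM2l => //.
  rewrite (_ : 2 * rc ^+ 2 * _ * x = 2 * (`|c2| / c1) * rc ^+ 2 * x); last by ring.
  apply: ler_wpM2l => //; rewrite mulr_ge0 ?sqr_ge0// mulr_ge0// divr_ge0//.
  exact: ltW.
rewrite -addrA; apply: le_trans (lerD S0x (lexx _)) _.
rewrite -!mulrDr; apply: ler_wpM2l => //.
have rx : 0 <= rc ^+ 2 * x by rewrite mulr_ge0// sqr_ge0.
have AZ : 0 <= A ^+ 2 * (CB ^+ 4 * Z).
  by rewrite mulr_ge0// mulr_ge0// exprn_ge0.
move: S0x devZ; set C2 := `|c2| / c1; set C16 := 16 / c1; set Y := CB ^+ 4 * Z in eZ AZ *.
move=> _ devZ; move: rx AZ eZ devZ; set A2' := A ^+ 2; set r2 := rc ^+ 2.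
move=> rx AZ eZ devZ; lra.
Qed.

Lemma risk_bound a ahat (x : R) :
  coefficients th CB a -> (forall t, coefficients th CB (ahat t)) ->
  (forall t, emp t (ahat t) <= emp t a) ->
  X_norm2 pb (fun i y => rann_pair th a i y - v y) = x%:E ->
  (\int[P2]_t expected_loss pb lam U (rann_pair th (ahat t)) <=
   (risk_cst * (x + rate))%:E)%E.
Proof.
move=> aCB ahatCB ahat_min Xa; have [K K_ge0 [Kx aK]] := C2_norms_le Xa.
have [n1|n1] := leqP n 1; last exact: risk_bound_many aCB ahatCB ahat_min K_ge0 Kx aK.
have {}n1 : n = 1%N by apply/eqP; rewrite eqn_leq n1.
rewrite -[leRHS]mule1 -(@probability_setT _ _ _ P2) -integral_cst//.
apply: le_integral_measurable_ub.
- by move=> t; exact: expected_loss_ge0.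
- move=> t; apply: le_trans (expected_loss_ge0 (ahat t)) _.
  exact: expected_loss_single n1 aCB (ahatCB t) K_ge0 Kx aK.
- exact: measurable_cst.
- apply: filterE => t.
  exact: expected_loss_single n1 aCB (ahatCB t) K_ge0 Kx aK.
Qed.

End risk_bound.

(** * Random hidden parameters *)

Lemma measurable_cube (R : realType) d (q : R) :
  measurable (cube q : set 'rV[R]_(d + 1)).
Proof.
rewrite (_ : cube q = box (const_mx (- q)) (const_mx q)); first exact: measurable_box.
apply/seteqP; split => x /= h i; have := h i; rewrite !mxE ler_norml//.
Qed.

(** The density vanishes off the cube. *)
Lemma iid_density_in_cube (R : realType) d (q : R) (p : 'rV[R]_(d + 1) -> R)
    (d1 : measure_display) (T1 : measurableType d1) (P1 : probability T1 R) M
    (theta : 'I_M -> T1 -> 'rV[R]_(d + 1)) :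
  density_on_cube q p -> iid P1 theta (density_law p) ->
  {ae P1, forall t, forall m, cube q (theta m t)}.
Proof.
move=> [_ _ p0 _] [mth thE _]; apply: filter_forall => m.
have mC := @measurable_cube R d q.
exists (~` (theta m @^-1` cube q)); split => //.
- apply: measurableC; rewrite -[X in measurable X]setTI.
  by apply: mth.
- change (~` (theta m @^-1` cube q)) with (theta m @^-1` (~` cube q)).
  rewrite thE; last exact: measurableC.
  rewrite /density_law (eq_integral (cst 0%E)) ?integral0// => x /set_mem nx.
  by rewrite p0.
Qed.

Theorem theorem3p5 (R : realType) (d : nat) (d_gt0 : (0 < d)%N)
    (pb : interface_problem R d) (geometry : interface_geometry pb)
    (U : 'I_5 -> probability 'rV[R]_d R)
    (uniform : forall k, uniform_on (@site_measure R d k) (site pb k) (U k))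
    (regularity : data_regularity pb U)
    (v : 'rV[R]_d -> R) (solution : exact_solution pb v)
    (v_barron : forall i, barron 4 (subdomain pb i) v)
    (lam : 'I_5 -> R) (lam_gt0 : forall k, 0 < lam k)
    (rho : R -> R) (rho_bump : bump_off_0 rho) (Cinv_neq0 : Cinv d rho != 0)
    (vA chi : 'I_2 -> 'rV[R]_d -> R)
    (vA_ext : forall i, barron_extension (subdomain pb i) v (vA i))
    (chi_cutoff : forall i, cutoff (subdomain pb i) (chi i))
    (c1 c2 : R) (c1_gt0 : 0 < c1) :
  exists C : R, 0 < C /\
  forall (M n : nat) (q CB : R) (p : 'rV[R]_(d + 1) -> R),
    (0 < M)%N -> (0 < n)%N -> 0 < q -> density_on_cube q p ->
    1 <= CB -> (Cq rho vA chi q p <= CB%:E)%E ->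
  forall (d1 : measure_display) (T1 : measurableType d1) (P1 : probability T1 R)
    (theta : 'I_2 -> 'I_M -> T1 -> 'rV[R]_(d + 1)),
    (forall i, iid P1 (theta i) (density_law p)) ->
  forall (d2 : measure_display) (T2 : measurableType d2) (P2 : probability T2 R)
    (N : 'I_5 -> nat) (X : forall k, 'I_(N k) -> T2 -> 'rV[R]_d),
    (forall k, c1 * n%:R <= (N k)%:R <= c2 * n%:R) ->
    (forall k, iid P2 (X k) (U k)) ->
  {ae P1, forall t1, let th := fun i m => theta i m t1 in
    forall ahat : T2 -> 'I_2 -> 'I_M -> R,
      (forall i m, measurable_fun setT (fun t => ahat t i m)) ->
      (forall t, coefficients th CB (ahat t) /\
         forall a, coefficients th CB a ->
           empirical_loss pb lam (fun k j => X k j t) (rann_pair th (ahat t)) <=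
           empirical_loss pb lam (fun k j => X k j t) (rann_pair th a)) ->
      (\int[P2]_t expected_loss pb lam U (rann_pair th (ahat t)) <=
       C%:E * (ereal_inf [set X_norm2 pb (fun i x => (rann_pair th a i x - v x)%R)
                         | a in coefficients th CB] +
               (CB ^+ 4 * M%:R * ln (CB * M%:R * (q + 1) * n%:R) / n%:R)%:E))%E}.
Proof.
have [r r_ge0 Or] : exists2 r : R, 0 <= r &
    forall x, closure (Omega pb) x -> forall j, `|x 0 j| <= r.
  have [[_ _ bO] _ _ _ _] := geometry.
  have [N [_ ON]] := bounded_set_closure bO.
  exists (`|N| + 1) => [|x Ox j]; first by rewrite addr_ge0.
  apply: le_trans (ON (`|N| + 1) _ x Ox); last first.
    by apply: le_lt_trans (ler_norm N) _; rewrite ltrDl.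
  rewrite [leRHS]mx_normrE.
  exact: (le_bigmax _ (fun ij : 'I_1 * 'I_d => `|x ij.1 ij.2|) (0, j)).
have [K0 K0_ge0 vK0] := trace_solution_bounded geometry solution d_gt0.
exists (risk_cst pb r K0 lam c1 c2).
split; first exact: risk_cst_gt0.
move=> M n q CB p M0 n0 q0 pcube CB1 _ d1 T1 P1 theta iid_theta.
move=> d2 T2 P2 N X N_n iidX.
have cube_ae : {ae P1, forall t, forall i m, cube q (theta i m t)}.
  by apply: filter_forall => i; exact: iid_density_in_cube pcube (iid_theta i).
apply: filterS cube_ae => t1 th_cube ahat _ ahat_min.
apply: le_mul_ereal_infD; first exact: risk_cst_gt0.
move=> _ [a aCB <-].
set y := CB ^+ 4 * _ * _ / _.
have y0 : 0 <= y by exact: rate_ge0.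
case Xa : (X_norm2 _ _) => [x| |].
- rewrite -EFinD -EFinM.
  apply: (risk_bound geometry uniform regularity solution r_ge0 K0_ge0 Or vK0
    c1_gt0 q0 M0 n0 th_cube CB1 N_n iidX aCB _ _ Xa).
  + by move=> t; have [] := ahat_min t.
  + by move=> t; have [_] := ahat_min t; apply.
- by rewrite addye// gt0_muley ?leey// lte_fin risk_cst_gt0.
- have := X_norm2_ge0 uniform
    (fun i x => rann_pair (fun i m => theta i m t1) a i x - v x).
  by rewrite Xa.
Qed.
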